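(* Let $K$ be an infinite field, $R=K[x_1,\ldots,x_n]$ the polynomial ring in $n\ge 1$ variables with the standard grading, and $\mathfrak m=(x_1,\ldots,x_n)$. Let $I$ be a homogeneous $\mathfrak m$-primary completely $\mathfrak m$-full ideal of $R$, and let $d$ be the minimum of all $j$ with $\beta_{n-1,n-1+j}(I)>0$. Then the following conditions are equivalent. (i) $R/I$ has the weak Lefschetz property. (ii) $\beta_{n-1,n-1+j}(I)=\beta_{0,j}(I)$ for all $j>d$. (iii) $\beta_{i,i+j}(I)=\binom{n-1}{i}\beta_{0,j}(I)$ for all $j>d$ and for all $i$.
   Context: A statement holds for a general linear form $x$ if it holds for all $x$ in some nonempty Zariski open subset of the $K$-vector space $R_1$ of linear forms. Completely $\mathfrak m$-full ideals are homogeneous ideals of polynomial rings $R=K[x_1,\ldots,x_n]$ with homogeneous maximal ideal $\mathfrak m=(x_1,\ldots,x_n)$, defined recursively: (1) if $n=0$ (so $R=K$ is a field), the zero ideal is completely $\mathfrak m$-full; (2) if $n>0$, $I$ is completely $\mathfrak m$-full if $\mathfrak m I:x=I$ and $(I+xR)/xR$ is completely $\mathfrak m$-full as an ideal of $R/xR$ (a polynomial ring in $n-1$ variables), where $x$ is a general linear form. $\beta_{i,j}(I)$ denotes the $(i,j)$th graded Betti number of $I$ as a graded $R$-module, i.e. $\beta_{i,j}(I)=\dim_K \mathrm{Tor}^R_i(I,K)_j$. For an $\mathfrak m$-primary homogeneous ideal $I$, write $A=R/I=\bigoplus_{i=0}^c A_i$ with $A_c\neq 0$. $A$ has the weak Lefschetz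 property (WLP) if there exists a linear form $L\in A_1$ such that the multiplication map $\times L:A_i\to A_{i+1}$ has full rank (i.e. is injective or surjective) for all $0\le i\le c-1$. *)

(* Defs.v *)
From HB Require Import structures.
From mathcomp Require Import all_boot all_order all_algebra.
From mathcomp Require Import mpoly.

Set Implicit Arguments.
Unset Strict Implicit.
Unset Printing Implicit Defensive.

Import GRing.Theory.
Local Open Scope ring_scope.

Definition infinite_field (K : fieldType) : Prop :=
  forall s : seq K, exists x : K, x \notin s.

(** Subsets of R = K[x_1, ..., x_n]; ideals are such subsets satisfying
    [is_ideal]. *)
Notation psubset K n := ({mpoly K[n]} -> Prop).

Section Ideals.
Variables (K : fieldType) (n : nat).
Local Notation R := {mpoly K[n]}.
Implicit Types (I J : psubset K n) (x p q : R).

Definition is_ideal I : Prop :=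
  [/\ I 0, forall p q, I p -> I q -> I (p + q) & forall p q, I q -> I (p * q)].

Definition homogeneous_ideal I : Prop :=
  is_ideal I /\ forall p d, I p -> I (pihomog mdeg d p).

Definition irrelevant_ideal : psubset K n :=
  fun p => exists c : 'I_n -> R, p = \sum_i c i * 'X_i.

Definition ideal_prod I J : psubset K n :=
  fun p => exists2 s : seq (R * R),
    (forall u, u \in s -> I u.1 /\ J u.2) & p = \sum_(u <- s) u.1 * u.2.

Definition colon I x : psubset K n := fun p => I (p * x).

Definition radical I : psubset K n := fun p => exists k : nat, I (p ^+ k).

Definition primary_ideal I : Prop :=
  [/\ is_ideal I, ~ I 1 & forall p q, I (p * q) -> I p \/ radical I q].

Definition m_primary I : Prop :=
  primary_ideal I /\ forall p, radical I p <-> irrelevant_ideal p.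

(** R_1 is identified with K^n through the coefficients of a linear form. *)
Definition linform (a : 'I_n -> K) : R := \sum_i a i *: 'X_i.

Definition zariski_open (U : ('I_n -> K) -> Prop) : Prop :=
  exists S : psubset K n, forall a, U a <-> exists2 f, S f & f.@[a] != 0.

Definition for_general_linform (P : R -> Prop) : Prop :=
  exists U : ('I_n -> K) -> Prop,
    [/\ zariski_open U, exists a, U a & forall a, U a -> P (linform a)].

End Ideals.

Section CompletelyMFull.
Variable K : fieldType.

(** [phi] induces an isomorphism of graded K-algebras from R/xR onto the
    polynomial ring in one variable less. *)
Definition graded_quotient_map (n : nat) (x : {mpoly K[n.+1]})
    (phi : {lrmorphism {mpoly K[n.+1]} -> {mpoly K[n]}}) : Prop :=
  [/\ forall d p, p \is d.-homog -> phi p \is d.-homog,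
      forall q, exists p, phi p = q
    & forall p, phi p = 0 <-> exists q, p = x * q].

Definition image_ideal (n m : nat) (phi : {mpoly K[n]} -> {mpoly K[m]})
    (I : psubset K n) : psubset K m :=
  fun q => exists2 p, I p & phi p = q.

(** (I + xR)/xR is read as the image of I under an identification of R/xR with
    a polynomial ring; being completely m-full does not depend on the choice of
    this identification. *)
Fixpoint completely_m_full (n : nat) : psubset K n -> Prop :=
  match n with
  | 0 => fun I => forall p, I p <-> p = 0
  | n'.+1 => fun I =>
      for_general_linform (fun x =>
        (forall p, colon (ideal_prod (@irrelevant_ideal K n'.+1) I) x p <-> I p)
        /\ exists2 phi, graded_quotient_map x phi
             & completely_m_full (image_ideal phi I))
  end.

End CompletelyMFull.

Section Betti.
Variables (K : fieldType) (n : nat).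
Local Notation R := {mpoly K[n]}.

(** Data of a complex ... -> F_1 -> F_0 -> R of graded free modules of finite
    rank, where F_i = \bigoplus_a R(- gdeg a), the sum running over
    a : 'I_(grank i); matrices act on row vectors. *)
Record graded_free_data := GradedFreeData {
  grank : nat -> nat;
  gdeg : forall i, 'I_(grank i) -> nat;
  gdiff : forall i, 'M[R]_(grank i.+1, grank i);
  gaug : 'cV[R]_(grank 0)
}.

Definition graded_free_resolution (F : graded_free_data) (I : psubset K n)
    : Prop :=
  [/\ (forall b, gaug F b 0 \is (gdeg b).-homog)
      /\ forall i (a : 'I_(grank F i.+1)) (b : 'I_(grank F i)),
        if (gdeg b <= gdeg a)%N then gdiff F i a b \is (gdeg a - gdeg b)%N.-homog
        else gdiff F i a b == 0,
      forall p, I p <-> exists v : 'rV_(grank F 0), p = (v *m gaug F) 0 0,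
      forall v : 'rV_(grank F 0),
        v *m gaug F = 0 <-> exists w, v = w *m gdiff F 0
    & forall i (v : 'rV_(grank F i.+1)),
        v *m gdiff F i = 0 <-> exists w, v = w *m gdiff F i.+1].

(** The differentials of F (x)_R K, where K = R/m: reducing modulo m is taking
    the constant coefficient. *)
Definition gdiffK (F : graded_free_data) (i : nat)
    : 'M[K]_(grank F i.+1, grank F i) :=
  map_mx (mcoeff 0%MM) (gdiff F i).

(** The row space of this matrix is the degree j part of F_i (x)_R K. *)
Definition gpart (F : graded_free_data) (i j : nat) : 'M[K]_(grank F i) :=
  diag_mx (\row_a (gdeg a == j)%:R).

Definition gcycles (F : graded_free_data) (i : nat) : 'M[K]_(grank F i) :=
  match i with
  | 0 => 1%:M
  | i'.+1 => kermx (gdiffK F i')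
  end.

(** dim_K H_i(F (x)_R K)_j: the boundaries form a subspace of the cycles, so the
    truncated subtraction is the dimension of the quotient. *)
Definition tor_dim (F : graded_free_data) (i j : nat) : nat :=
  (\rank (gcycles F i :&: gpart F i j)%MS
   - \rank (gdiffK F i :&: gpart F i j)%MS)%N.

(** beta i j = dim_K Tor_i(I, K)_j for all i and j. Tor does not depend on the
    resolution, and one of this form exists as R is noetherian. *)
Definition graded_betti_numbers (I : psubset K n) (beta : nat -> nat -> nat)
    : Prop :=
  exists2 F, graded_free_resolution F I & forall i j, beta i j = tor_dim F i j.

End Betti.

Section WeakLefschetz.
Variables (K : fieldType) (n : nat).
Local Notation R := {mpoly K[n]}.
Implicit Type I : psubset K n.

(** A_i = 0, where A = R/I and A_i = R_i/(I \cap R_i). *)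
Definition quotient_part_zero I (i : nat) : Prop :=
  forall p : R, p \is i.-homog -> I p.

Definition top_degree I (c : nat) : Prop :=
  ~ quotient_part_zero I c /\ forall i, (c < i)%N -> quotient_part_zero I i.

(** Injectivity and surjectivity of (x L) : A_i -> A_{i+1}, on representatives. *)
Definition mul_injective I (L : R) (i : nat) : Prop :=
  forall p : R, p \is i.-homog -> I (L * p) -> I p.

Definition mul_surjective I (L : R) (i : nat) : Prop :=
  forall q : R, q \is i.+1.-homog ->
    exists2 p : R, p \is i.-homog & I (q - L * p).

Definition weak_lefschetz I : Prop :=
  exists2 c, top_degree I c
    & exists2 L : R, L \is 1.-homog
      & forall i, (i < c)%N -> mul_injective I L i \/ mul_surjective I L i.

End WeakLefschetz.

(* Main.v *)
Require Import Defs.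
From Stdlib Require Import Classical ClassicalEpsilon.
From mathcomp Require Import all_boot all_order all_algebra.
From mathcomp Require Import mpoly.

(** Let x be a general linear form, J the image of I in R/xR, a polynomial ring in
    n - 1 variables, and s_j = dim ((I \cap xR) / xI)_j. As mI : x = I, the
    submodule (I \cap xR)/xI of I/xI is killed by m and meets m(I/xI) trivially, so
    it splits off: I/xI = J (+) V with V a vector space. As x is regular on I,
      beta_{i,i+j}(I) = beta_{i,i+j}(J) + 'C(n-1, i) s_j,
    where J is again completely m-full. Iterating, the numbers beta_{i,i+j}(J) vanish
    for i >= n - 1, and for all i as soon as beta_{0,j}(J) = 0. So s_j is
    beta_{n-1,n-1+j}(I), and (ii) and (iii) both say that J is generated in
    degrees <= d. On the other hand I : x = I : m, so that x : A_i -> A_{i+1} is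
    injective for i < d - 1 while no linear form is injective on A_{d-1}; hence the
    WLP means that (R/xR)_d is contained in J, and for an m-primary completely
    m-full ideal J this is again generation in degrees <= d.

    Betti numbers are computed from an arbitrary resolution F of I by comparing F (x) K
    and I through F (x) Koszul complex; Koszul complexes are iterated mapping cones,
    the linear forms being chosen one after the other along the successive
    quotients. *)

Set Implicit Arguments.
Unset Strict Implicit.
Unset Printing Implicit Defensive.

Import GRing.Theory.
Local Open Scope ring_scope.

(** * Identities in abelian groups *)

(** When V is nonzero, no linear form is regular on I/xI, so reducing a resolution by further forms
    loses exactness. Koszul complexes avoid this: a cone preserves quasi-isomorphisms whether or not
    the form is regular, so the comparison of F with I survives all forms, while F itself, being
    free, can be reduced until no variable is left. On V the remaining n - 1 forms act by zero; the
    Koszul differential then vanishes, which is where the binomial coefficient comes from.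

    I : x = I : m holds because xq in I puts yxq in mI for every linear form y, hence yq in mI : x =
    I. So the kernel of x on A is the socle and is killed by every linear form: a nonzero kernel in
    degree d - 1 leaves surjectivity as the only way to full rank there.

    If J is generated in degrees <= d, the next general form is injective on R'/J from degree d on,
    where R' = R/xR; since R'/J vanishes in large degrees, it vanishes from degree d on.

    Quotient modules are never formed. A subquotient is a pair of predicates on an ambient module,
    and its dimension is a relation carried along maps that need only be defined on
    representatives. *)

Section ZmoduleIdentities.
Variable V : zmodType.

Inductive zexpr := ZVar of nat | ZZero | ZAdd of zexpr & zexpr | ZOpp of zexpr.

Fixpoint zeval (e : seq V) t : V :=
  match t with
  | ZVar k => nth 0 e k
  | ZZero => 0
  | ZAdd a b => zeval e a + zeval e b
  | ZOpp a => - zeval e a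
  end.

Fixpoint zcoef t (k : nat) : int :=
  match t with
  | ZVar l => (k == l)%:Z
  | ZZero => 0
  | ZAdd a b => zcoef a k + zcoef b k
  | ZOpp a => - zcoef a k
  end.

Lemma zevalE e t : zeval e t = \sum_(k < size e) nth 0 e k *~ zcoef t k.
Proof.
elim: t => [l||a IHa b IHb|a IHa] /=.
- case: (ltnP l (size e)) => hl.
    rewrite (bigD1 (Ordinal hl)) //= eqxx mulr1z big1 ?addr0 // => k.
    by rewrite -val_eqE /= => /negbTE ->.
  rewrite nth_default // big1 // => k _.
  by rewrite (ltn_eqF (leq_trans (ltn_ord k) hl)).
- by rewrite big1.
- by rewrite IHa IHb -big_split; apply: eq_bigr => k _; rewrite mulrzDr.
- by rewrite IHa -sumrN; apply: eq_bigr => k _; rewrite mulrNz.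
Qed.

(** Soundness of a reflexive test: comparing the integer coefficients of the listed atoms is enough,
    since an index beyond [size e] evaluates to 0. *)
Lemma zeval_eq e t1 t2 :
  all (fun k => zcoef t1 k == zcoef t2 k) (iota 0 (size e)) ->
  zeval e t1 = zeval e t2.
Proof.
move=> /allP h; rewrite !zevalE; apply: eq_bigr => k _.
by rewrite (eqP (h _ _)) // mem_iota ltn_ord.
Qed.

End ZmoduleIdentities.

(* [*:] is compared through its arguments only, since the module structure can be
   inferred along several convertible paths. *)
Ltac zmod_index x e :=
  lazymatch e with
  | ?y :: ?e' =>
    match constr:((x, y)) with
    | (?z, ?z) => constr:(0%N)
    | (@GRing.scale _ _ ?a ?u, @GRing.scale _ _ ?a ?u) => constr:(0%N)
    | _ => let k := zmod_index x e' in constr:(k.+1)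
    end
  end.
Ltac zmod_add x e :=
  match e with
  | _ => let _ := zmod_index x e in e
  | _ => constr:(x :: e)
  end.
Ltac zmod_atoms t e :=
  lazymatch t with
  | ?a + ?b => let e1 := zmod_atoms a e in zmod_atoms b e1
  | - ?a => zmod_atoms a e
  | 0 => e
  | _ => zmod_add t e
  end.
Ltac zmod_reify t e :=
  lazymatch t with
  | ?a + ?b =>
    let ra := zmod_reify a e in let rb := zmod_reify b e in constr:(ZAdd ra rb)
  | - ?a => let ra := zmod_reify a e in constr:(ZOpp ra)
  | 0 => constr:(ZZero)
  | _ => let k := zmod_index t e in constr:(ZVar k)
  end.
Ltac zmod :=
  (* Degrees such as [i.+1.-1] are normalised first, so that atoms in the same term of a complex are
     recognised as equal. *)
  cbn [Nat.pred];
  lazymatch goal with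
  | |- @eq ?V ?a ?b =>
    let e0 := zmod_atoms a (@nil V) in
    let e := zmod_atoms b e0 in
    let ra := zmod_reify a e in
    let rb := zmod_reify b e in
    exact: (@zeval_eq _ e ra rb isT)
  end.

(** * Dimensions of subquotients *)

Lemma choice_fun (A B : Type) (P : A -> B -> Prop) :
  (forall a, exists b, P a b) -> exists f : A -> B, forall a, P a (f a).
Proof.
move=> h; exists (fun a => proj1_sig (constructive_indefinite_description _ (h a))).
by move=> a; case: constructive_indefinite_description.
Qed.

Section Subquotients.
Variables (K : fieldType) (n : nat) (T : lmodType {mpoly K[n]}).
Implicit Types (Z B : T -> Prop) (c : nat -> K) (v w : nat -> T) (z : T).

(** K acts on an R-module through the constants [a%:MP], so a single module structure serves both
    rings. *)
Definition subsp B :=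
  B 0 /\ forall (a : K) (u w : T), B u -> B w -> B (a%:MP *: u + w).

Lemma subsp0 B : subsp B -> B 0. Proof. by case. Qed.

Lemma subspD B (u w : T) : subsp B -> B u -> B w -> B (u + w).
Proof. by case=> _ h hu hw; have := h 1 u w hu hw; rewrite mpolyC1 scale1r. Qed.

Lemma subspZ B (a : K) (u : T) : subsp B -> B u -> B (a%:MP *: u).
Proof. by case=> h0 h hu; have := h a u 0 hu h0; rewrite addr0. Qed.

Lemma subspN B (u : T) : subsp B -> B u -> B (- u).
Proof.
move=> sB hu; have := subspZ (-1) sB hu.
by rewrite mpolyCN mpolyC1 scaleN1r.
Qed.

Lemma subspB B (u w : T) : subsp B -> B u -> B w -> B (u - w).
Proof. by move=> sB hu hw; apply: subspD => //; apply: subspN. Qed.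

Lemma subsp_sum B (I : Type) (r : seq I) (P : pred I) (F : I -> T) :
  subsp B -> (forall i, P i -> B (F i)) -> B (\sum_(i <- r | P i) F i).
Proof.
move=> sB h; elim/big_rec: _ => [|i u Pi hu]; first exact: subsp0.
by apply: subspD => //; apply: h.
Qed.

(** Families are total functions on [nat] cut off at m, so that extending or concatenating bases is
    index arithmetic. *)
Definition cmb m c v : T := \sum_(k < m) (c k)%:MP *: v k.

Definition spans B m v z := exists c, B (z - cmb m c v).

Definition indep B m v := forall c, B (cmb m c v) -> forall k, (k < m)%N -> c k = 0.

(** dim_K Z / (Z \cap B) = m. *)
Definition is_dim Z B (m : nat) := exists v,
  [/\ forall k, (k < m)%N -> Z (v k), forall z, Z z -> spans B m v z
    & indep B m v].

Lemma cmbD m c c' v : cmb m (fun k => c k + c' k) v = cmb m c v + cmb m c' v.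
Proof.
by rewrite /cmb -big_split; apply: eq_bigr => k _; rewrite mpolyCD scalerDl.
Qed.

Lemma cmbZ m a c v : cmb m (fun k => a * c k) v = a%:MP *: cmb m c v.
Proof.
by rewrite /cmb scaler_sumr; apply: eq_bigr => k _; rewrite mpolyCM scalerA.
Qed.

Lemma cmbN m c v : cmb m (fun k => - c k) v = - cmb m c v.
Proof.
by rewrite /cmb -sumrN; apply: eq_bigr => k _; rewrite mpolyCN scaleNr.
Qed.

Lemma eq_cmb m c c' v v' : (forall k, (k < m)%N -> c k = c' k) ->
  (forall k, (k < m)%N -> v k = v' k) -> cmb m c v = cmb m c' v'.
Proof. by move=> hc hv; apply: eq_bigr => k _; rewrite hc ?hv. Qed.

Lemma cmb_subsp B m c v : subsp B -> (forall k, (k < m)%N -> B (v k)) ->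
  B (cmb m c v).
Proof. by move=> sB h; apply: subsp_sum => // k _; apply: subspZ => //; apply: h. Qed.

(** The coordinates of [v] with respect to [w] form an m x N matrix, row free because [v] is
    independent modulo B. This bounds m by N; for m = N the matrix is invertible and its inverse
    expresses [w] through [v]. *)
Lemma indep_spans B m v N w : subsp B -> indep B m v ->
  (forall k, (k < m)%N -> spans B N w (v k)) ->
  (m <= N)%N /\ (m = N -> forall l, (l < N)%N -> spans B m v (w l)).
Proof.
move=> sB iv hs.
have [M hM] : exists M : nat -> nat -> K,
    forall k, (k < m)%N -> B (v k - cmb N (M k) w).
  apply: (choice_fun (P := fun k c => (k < m)%N -> B (v k - cmb N c w))) => k.
  case: (ltnP k m) => [/hs[c hc]|_]; first by exists c.
  by exists (fun=> 0).
pose A : 'M[K]_(m, N) := \matrix_(k, l) M k l.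
have comb (c : 'rV[K]_m) : B (\sum_(k < m) (c 0 k)%:MP *: v k
    - \sum_(l < N) ((c *m A) 0 l)%:MP *: w l).
  have -> : \sum_(l < N) ((c *m A) 0 l)%:MP *: w l =
      \sum_(k < m) (c 0 k)%:MP *: cmb N (M k) w.
    under [RHS]eq_bigr => k _ do rewrite scaler_sumr.
    rewrite exchange_big; apply: eq_bigr => l _; rewrite mxE.
    rewrite rmorph_sum scaler_suml; apply: eq_bigr => k _.
    by rewrite scalerA mxE rmorphM.
  rewrite -sumrB; apply: subsp_sum => // k _.
  by rewrite -scalerBr; apply: subspZ => //; apply: hM.
have freeA : row_free A.
  apply: inj_row_free => c.
    move=> cA0; apply/rowP => k; have := comb c; rewrite cA0 mxE.
    rewrite [X in _ - X]big1 ?subr0 => [hB|l _]; last by rewrite mxE mpolyC0 scale0r.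
    pose c' k := if insub k is Some k' then c 0 k' else 0.
    have := iv c'; rewrite /cmb.
    have -> : \sum_(k0 < m) (c' k0)%:MP *: v k0 = \sum_(k0 < m) (c 0 k0)%:MP *: v k0.
      by apply: eq_bigr => k0 _; rewrite /c' valK.
    by move/(_ hB k (ltn_ord k)); rewrite /c' valK.
split; first by rewrite -(eqP freeA) rank_leq_col.
move=> emN; subst N => l hl.
have uA : A \in unitmx by rewrite -row_free_unit.
pose c : 'rV_m := row (Ordinal hl) (invmx A).
have := comb c; rewrite -row_mul mulVmx //.
have -> : \sum_(l0 < m) ((row (Ordinal hl) 1%:M) 0 l0)%:MP *: w l0 = w l.
  rewrite (bigD1 (Ordinal hl)) //= big1 => [|l' ne]; rewrite !mxE.
    by rewrite eqxx mpolyC1 scale1r addr0.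
  by rewrite eq_sym (negbTE ne) mpolyC0 scale0r.
pose c' k := if insub k is Some k' then c 0 k' else 0.
move=> hB; exists c'; have -> : cmb m c' v = \sum_(k < m) (c 0 k)%:MP *: v k.
  by apply: eq_bigr => k _; rewrite /c' valK.
by rewrite -opprB; apply: subspN.
Qed.

Lemma is_dim_uniq Z B m m' : subsp B -> is_dim Z B m -> is_dim Z B m' -> m = m'.
Proof.
move=> sB [v [Zv sv iv]] [w [Zw sw iw]]; apply/eqP; rewrite eqn_leq.
apply/andP; split.
  by have [] := indep_spans sB iv (fun k hk => sw _ (Zv k hk)).
by have [] := indep_spans sB iw (fun k hk => sv _ (Zw k hk)).
Qed.

Lemma is_dim0 Z B : is_dim Z B 0 <-> forall z, Z z -> B z.
Proof.
split=> [[v [_ sv _]] z /sv[c]|h]; first by rewrite /cmb big_ord0 subr0.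
exists (fun=> 0); split=> // z /h Bz; exists (fun=> 0).
by rewrite /cmb big_ord0 subr0.
Qed.

Lemma cmb_rcons m c v z :
  cmb m.+1 c (fun k => if (k < m)%N then v k else z) = cmb m c v + (c m)%:MP *: z.
Proof.
rewrite /cmb big_ord_recr /= ltnn; congr (_ + _).
by apply: eq_bigr => k _; rewrite ltn_ord.
Qed.

(** Vectors of Z outside the current span are added one at a time. By [indep_spans] no independent
    family exceeds N members, so N - m decreases to 0; [w] only bounds the length and may lie
    outside Z. *)
Lemma basis_extension Z B N w m v : subsp B ->
  (forall z, Z z -> spans B N w z) ->
  (forall k, (k < m)%N -> Z (v k)) -> indep B m v ->
  exists p v', [/\ forall k, (k < m)%N -> v' k = v k,
    forall k, (k < m + p)%N -> Z (v' k), forall z, Z z -> spans B (m + p) v' z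
    & indep B (m + p) v'].
Proof.
move=> sB sw; have [r] := ubnP (N - m)%N; elim: r m v => // r IH m v hr Zv iv.
have [h|/not_all_ex_not[z /(@imply_to_and (Z z))[Zz nz]]] :=
  classic (forall z, Z z -> spans B m v z).
  by exists 0%N, v; rewrite addn0.
pose v1 k := if (k < m)%N then v k else z.
have Zv1 k : (k < m.+1)%N -> Z (v1 k).
  by rewrite /v1; case: ifP => [hk _|_ _] //; apply: Zv.
have iv1 : indep B m.+1 v1.
  move=> c; rewrite cmb_rcons => Bc.
  have cm0 : c m = 0.
    apply/eqP; apply/negPn/negP => cm; apply: nz.
    exists (fun k => - ((c m)^-1 * c k)); rewrite cmbN opprK cmbZ.
    have := subspZ (c m)^-1 sB Bc.
    by rewrite scalerDr scalerA -mpolyCM mulVf // mpolyC1 scale1r addrC.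
  move=> k; rewrite ltnS leq_eqVlt => /orP[/eqP -> //|].
  by apply: iv; move: Bc; rewrite cm0 mpolyC0 scale0r addr0.
have [hm _] := indep_spans sB iv1 (fun k hk => sw _ (Zv1 k hk)).
have [] := IH m.+1 v1 _ Zv1 iv1.
  by rewrite -ltnS; apply: leq_trans hr; rewrite ltnS ltn_sub2l.
move=> p [v' [e Zv' sv' iv']]; exists p.+1, v'; rewrite addnS -addSn; split=> //.
by move=> k hk; rewrite e ?ltnS 1?ltnW // /v1 hk.
Qed.

Lemma is_dim_exists Z B N w : subsp B ->
  (forall z, Z z -> spans B N w z) -> exists m, is_dim Z B m.
Proof.
move=> sB sw; have [||p [v [_ h1 h2 h3]]] := @basis_extension Z B N w 0 (fun=> 0) sB sw.
- by [].
- by [].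
by exists p, v.
Qed.

End Subquotients.

(** Dividing out a linear form changes the base ring, so linearity is taken along a ring map [g]. *)
Definition semilin (K : fieldType) (n n' : nat) (T : lmodType {mpoly K[n]})
    (T' : lmodType {mpoly K[n']}) (g : {mpoly K[n]} -> {mpoly K[n']})
    (f : T -> T') :=
  forall a u v, f (a *: u + v) = g a *: f u + f v.

Section DimTransfer.
Variables (K : fieldType) (n n' : nat).
Variables (T : lmodType {mpoly K[n]}) (T' : lmodType {mpoly K[n']}).
Variables (g : {lrmorphism {mpoly K[n]} -> {mpoly K[n']}}) (f : T -> T').
Hypothesis lin_f : semilin g f.

Lemma semilinD u v : f (u + v) = f u + f v.
Proof. by have := lin_f 1 u v; rewrite rmorph1 !scale1r. Qed.

Lemma semilin0 : f 0 = 0.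
Proof. by apply: (addrI (f 0)); rewrite -semilinD !addr0. Qed.

Lemma semilinZ a u : f (a *: u) = g a *: f u.
Proof. by have := lin_f a u 0; rewrite semilin0 !addr0. Qed.

Lemma semilinN u : f (- u) = - f u.
Proof. by rewrite -scaleN1r semilinZ rmorphN1 scaleN1r. Qed.

Lemma semilinB u v : f (u - v) = f u - f v.
Proof. by rewrite semilinD semilinN. Qed.

Lemma lrmorph_mpolyC (a : K) : g a%:MP = a%:MP.
Proof.
by rewrite -[a%:MP]mulr1 mul_mpolyC linearZ /= rmorph1 -mul_mpolyC mulr1.
Qed.

Lemma semilin_cmb m c v : f (cmb m c v) = cmb m c (fun k => f (v k)).
Proof.
rewrite /cmb; elim/big_rec2: _ => [|k u w _ <-]; first exact: semilin0.
by rewrite semilinD semilinZ lrmorph_mpolyC.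
Qed.

Variables (Z B : T -> Prop) (Z' B' : T' -> Prop).
Hypotheses (sZ : subsp Z) (sB' : subsp B').
Hypothesis fZ : forall u, Z u -> Z' (f u).
Hypothesis fB : forall u, Z u -> (B u <-> B' (f u)).
Hypothesis f_onto : forall u', Z' u' -> exists2 u, Z u & B' (u' - f u).

(** The hypotheses make [f] an isomorphism of the two subquotients: a basis is pushed forward along
    [f], or pulled back by choosing preimages modulo B'. *)
Lemma is_dim_transfer m : is_dim Z B m <-> is_dim Z' B' m.
Proof.
split=> [[v [Zv sv iv]]|[v' [Zv' sv' iv']]].
  exists (fun k => f (v k)); split=> [k hk|z'|c].
  - exact/fZ/Zv.
  - move=> /f_onto[z Zz Bz]; have [c Bc] := sv z Zz; exists c.
    move: Bc => /fB; rewrite semilinB semilin_cmb => Bc.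
    have -> : z' - cmb m c (fun k => f (v k)) =
      (z' - f z) + (f z - cmb m c (fun k => f (v k))) by zmod.
    by apply: subspD => //; apply: Bc; apply: subspB => //; apply: cmb_subsp.
  - by rewrite -semilin_cmb => /fB Bc; apply: iv; apply: Bc; apply: cmb_subsp.
have [v hv] : exists v : nat -> T,
    forall k, (k < m)%N -> Z (v k) /\ B' (v' k - f (v k)).
  apply: (choice_fun (P := fun k u => (k < m)%N -> Z u /\ B' (v' k - f u))) => k.
  by case: (ltnP k m) => [/Zv'/f_onto[u ? ?]|_]; [exists u | exists 0].
have Zv k : (k < m)%N -> Z (v k) by move=> /hv[].
have Bc c : B' (cmb m c v' - f (cmb m c v)).
  rewrite semilin_cmb /cmb -sumrB; apply: subsp_sum => // k _.
  by rewrite -scalerBr; apply: subspZ => //; have [] := hv k (ltn_ord k).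
exists v; split=> // [z Zz|c].
  have [c hc] := sv' _ (fZ Zz); exists c; apply/fB.
    by apply: subspB => //; apply: cmb_subsp.
  rewrite semilinB.
  have -> : f z - f (cmb m c v) =
    (f z - cmb m c v') + (cmb m c v' - f (cmb m c v)) by zmod.
  exact: subspD.
have /fB fBc : Z (cmb m c v) by exact: cmb_subsp.
move=> /fBc h; apply: iv'; rewrite -[cmb m c v'](subrK (f (cmb m c v))).
exact: (subspD sB' (Bc c) h).
Qed.

End DimTransfer.

Section DimSum.
Variables (K : fieldType) (n : nat) (T1 T2 T : lmodType {mpoly K[n]}).
Variables (f1 : T1 -> T) (f2 : T2 -> T).
Hypotheses (lin1 : semilin id f1) (lin2 : semilin id f2).
Variables (Z1 B1 : T1 -> Prop) (Z2 B2 : T2 -> Prop) (Z B : T -> Prop).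
Hypotheses (sZ1 : subsp Z1) (sZ2 : subsp Z2).
Hypothesis Zsum : forall u1 u2, Z1 u1 -> Z2 u2 -> Z (f1 u1 + f2 u2).
Hypothesis Zdec : forall z, Z z -> exists u1 u2, [/\ Z1 u1, Z2 u2 & z = f1 u1 + f2 u2].
Hypothesis Bsum : forall u1 u2, Z1 u1 -> Z2 u2 ->
  (B (f1 u1 + f2 u2) <-> B1 u1 /\ B2 u2).

Lemma is_dim_sum m1 m2 : is_dim Z1 B1 m1 -> is_dim Z2 B2 m2 -> is_dim Z B (m1 + m2).
Proof.
move=> [v1 [Zv1 sv1 iv1]] [v2 [Zv2 sv2 iv2]].
pose v k := if (k < m1)%N then f1 (v1 k) else f2 (v2 (k - m1)%N).
have L1 := @semilin_cmb K n n T1 T idfun f1 lin1.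
have L2 := @semilin_cmb K n n T2 T idfun f2 lin2.
have D1 := @semilinB K n n T1 T idfun f1 lin1.
have D2 := @semilinB K n n T2 T idfun f2 lin2.
have vE c : cmb (m1 + m2) c v =
    f1 (cmb m1 c v1) + f2 (cmb m2 (fun k => c (m1 + k)%N) v2).
  rewrite L1 L2 /cmb big_split_ord /=; congr (_ + _); apply: eq_bigr => k _.
    by rewrite /v ltn_ord.
  by rewrite /v ltnNge leq_addr /= addKn.
exists v; split=> [k hk|z|c].
- rewrite /v; case: ltnP => h.
    have := Zsum (Zv1 _ h) (subsp0 sZ2).
    by rewrite (@semilin0 K n n T2 T idfun f2 lin2) addr0.
  have := Zsum (subsp0 sZ1) (Zv2 (k - m1)%N _).
  by rewrite (@semilin0 K n n T1 T idfun f1 lin1) add0r; apply; rewrite ltn_subLR.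
- move=> /Zdec[u1 [u2 [h1 h2 ->]]].
  have [c1 hc1] := sv1 _ h1; have [c2 hc2] := sv2 _ h2.
  exists (fun k => if (k < m1)%N then c1 k else c2 (k - m1)%N); rewrite vE.
  have -> : cmb m1 (fun k => if (k < m1)%N then c1 k else c2 (k - m1)%N) v1 =
    cmb m1 c1 v1 by apply: eq_cmb => // k ->.
  have -> : cmb m2 (fun k => if (m1 + k < m1)%N then c1 (m1 + k)%N
      else c2 (m1 + k - m1)%N) v2 = cmb m2 c2 v2.
    by apply: eq_cmb => // k _; rewrite ltnNge leq_addr /= addKn.
  have -> : f1 u1 + f2 u2 - (f1 (cmb m1 c1 v1) + f2 (cmb m2 c2 v2)) =
      f1 (u1 - cmb m1 c1 v1) + f2 (u2 - cmb m2 c2 v2).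
    by rewrite D1 D2; zmod.
  by apply/Bsum => //; apply: subspB => //; apply: cmb_subsp.
- rewrite vE => /Bsum[||h1 h2]; try exact: cmb_subsp.
  move=> k hk; case: (ltnP k m1) => h; first exact: (iv1 c).
  rewrite -(subnKC h); apply: (iv2 (fun k => c (m1 + k)%N)) => //.
  by rewrite ltn_subLR.
Qed.

End DimSum.

(** * Bigraded complexes and mapping cones *)

(** A bigraded complex of modules over K[x_1, ..., x_n]: the term in homological
    degree i and internal degree j is the K-space [cC i j] / [cN i j]; the
    differential starting in homological degree 0 is a dummy. *)
Record cplx (K : fieldType) (n : nat) := Cplx {
  cT : nat -> lmodType {mpoly K[n]};
  cd : forall i, cT i -> cT i.-1;
  cC : forall i, nat -> cT i -> Prop;
  cN : forall i, nat -> cT i -> Prop;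
  cd_lin : forall i, semilin id (@cd i);
  cdd : forall i (u : cT i), cd (cd u) = 0;
  cd_eq0 : forall j (u : cT 0), cC j u -> cd u = 0;
  cC_sub : forall i j, subsp (@cC i j);
  cN_sub : forall i j, subsp (@cN i j);
  cNC : forall i j (u : cT i), cN j u -> cC j u;
  cCd : forall i j (u : cT i), cC j u -> cC j (cd u);
  cNd : forall i j (u : cT i), cN j u -> cN j (cd u);
  cCy : forall i j (y : {mpoly K[n]}) (u : cT i),
    y \is 1.-homog -> cC j u -> cC j.+1 (y *: u);
  cNy : forall i j (y : {mpoly K[n]}) (u : cT i),
    y \is 1.-homog -> cN j u -> cN j.+1 (y *: u)
}.

Section Complexes.
Variables (K : fieldType) (n : nat).
Implicit Type X : cplx K n.

Section Basics.
Variable X : cplx K n.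
Variables (i j : nat).
Implicit Types u w : cT X i.

Lemma cdD u w : cd (u + w) = cd u + cd w.
Proof. exact: (@semilinD _ _ _ _ _ idfun _ (cd_lin (i:=i))). Qed.
Lemma cdB u w : cd (u - w) = cd u - cd w.
Proof. exact: (@semilinB _ _ _ _ _ idfun _ (cd_lin (i:=i))). Qed.
Lemma cdN u : cd (- u) = - cd u.
Proof. exact: (@semilinN _ _ _ _ _ idfun _ (cd_lin (i:=i))). Qed.
Lemma cdZ a u : cd (a *: u) = a *: cd u.
Proof. exact: (@semilinZ _ _ _ _ _ idfun _ (cd_lin (i:=i))). Qed.
Lemma cd0 : cd (0 : cT X i) = 0.
Proof. exact: (@semilin0 _ _ _ _ _ idfun _ (cd_lin (i:=i))). Qed.

Lemma CD u w : cC j u -> cC j w -> cC j (u + w).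
Proof. exact: (subspD (cC_sub X i j)). Qed.
Lemma CB u w : cC j u -> cC j w -> cC j (u - w).
Proof. exact: (subspB (cC_sub X i j)). Qed.
Lemma CN u : cC j u -> cC j (- u). Proof. exact: (subspN (cC_sub X i j)). Qed.
Lemma C0 : cC j (0 : cT X i). Proof. exact: (subsp0 (cC_sub X i j)). Qed.
Lemma ND u w : cN j u -> cN j w -> cN j (u + w).
Proof. exact: (subspD (cN_sub X i j)). Qed.
Lemma NB u w : cN j u -> cN j w -> cN j (u - w).
Proof. exact: (subspB (cN_sub X i j)). Qed.
Lemma NN u : cN j u -> cN j (- u). Proof. exact: (subspN (cN_sub X i j)). Qed.
(** The working form of diagram chases: a combination of known elements of [cN] is matched with the
    goal by [zmod]. *)
Lemma cN_eq u w : cN j u -> u = w -> cN j w. Proof. by move=> h <-. Qed.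
Lemma N0 : cN j (0 : cT X i). Proof. exact: (subsp0 (cN_sub X i j)). Qed.

End Basics.

Section Homology.
Variable X : cplx K n.
Variables (i j : nat).
Implicit Types u w : cT X i.

Definition cZ u := cC j u /\ cN j (cd u).
Definition cB u := cC j u /\ exists2 w : cT X i.+1, cC j w & cN j (u - cd w).

Lemma cZ_sub : subsp cZ.
Proof.
split=> [|a u w [Cu Nu] [Cw Nw]]; first by split; rewrite ?cd0; [apply: C0|apply: N0].
split; first by case: (cC_sub X i j) => _; apply.
by rewrite (cd_lin (i:=i)); case: (cN_sub X i.-1 j) => _; apply.
Qed.

Lemma cB_sub : subsp cB.
Proof.
split=> [|a u w [Cu [u1 Cu1 Nu]] [Cw [w1 Cw1 Nw]]].
  by split; [apply: C0|exists 0; rewrite ?cd0 ?subr0; [apply: C0|apply: N0]].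
split; first by case: (cC_sub X i j) => _; apply.
exists (a%:MP *: u1 + w1); first by case: (cC_sub X i.+1 j) => _; apply.
have [_ h] := cN_sub X i j; apply: (cN_eq (h a _ _ Nu Nw)).
by rewrite (cd_lin (i:=i.+1)) /= scalerBr; zmod.
Qed.

Lemma cBZ u : cB u -> cZ u.
Proof.
move=> [Cu [w Cw Nw]]; split=> //.
by have := cNd Nw; rewrite cdB (cdd w) subr0.
Qed.

End Homology.

Definition is_hdim X i j m := is_dim (@cZ X i j) (@cB X i j) m.

End Complexes.

(** Commutation with the differentials is asked modulo [cN] only: the projection from a cone of y to
    a quotient kills multiples of y just up to [cN]. *)
Record chain_map (K : fieldType) (n n' : nat)
    (g : {lrmorphism {mpoly K[n]} -> {mpoly K[n']}}) (X : cplx K n) (X' : cplx K n')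
    (f : forall i, cT X i -> cT X' i) : Prop := ChainMap {
  cm_lin : forall i, semilin g (f i);
  cmC : forall i j (u : cT X i), cC j u -> cC j (f i u);
  cmN : forall i j (u : cT X i), cN j u -> cN j (f i u);
  cm_d : forall i j (u : cT X i), cC j u -> cN j (f i.-1 (cd u) - cd (f i u))
}.

Definition quasi_iso (K : fieldType) (n n' : nat)
    (g : {lrmorphism {mpoly K[n]} -> {mpoly K[n']}}) (X : cplx K n) (X' : cplx K n')
    (f : forall i, cT X i -> cT X' i) : Prop :=
  [/\ chain_map g f,
    forall i j (u : cT X i), cZ j u -> cB j (f i u) -> cB j u
  & forall i j (u' : cT X' i), cZ j u' -> exists2 u, cZ j u & cB j (u' - f i u)].

Section QuasiIso.
Variables (K : fieldType) (n n' : nat).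
Variable g : {lrmorphism {mpoly K[n]} -> {mpoly K[n']}}.
Variables (X : cplx K n) (X' : cplx K n') (f : forall i, cT X i -> cT X' i).
Arguments f : clear implicits.
Hypothesis cm : chain_map g f.

Lemma cmD i u w : f i (u + w) = f i u + f i w.
Proof. exact: (semilinD (cm_lin cm (i:=i))). Qed.
Lemma cmB i u w : f i (u - w) = f i u - f i w.
Proof. exact: (semilinB (cm_lin cm (i:=i))). Qed.

Lemma cm_Z i j u : cZ j u -> cZ j (f i u).
Proof.
move=> [Cu Nu]; split; first exact: (cmC cm).
by apply: (cN_eq (NB (cmN cm Nu) (cm_d cm Cu))); zmod.
Qed.

Lemma cm_B i j u : cB j u -> cB j (f i u).
Proof.
move=> [Cu [w Cw Nw]]; split; first exact: (cmC cm).
exists (f i.+1 w); first exact: (cmC cm).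
have := cmN cm Nw; rewrite cmB => N1.
by apply: (cN_eq (ND N1 (cm_d cm Cw))); zmod.
Qed.

End QuasiIso.

Lemma quasi_iso_hdim (K : fieldType) (n n' : nat)
    (g : {lrmorphism {mpoly K[n]} -> {mpoly K[n']}}) (X : cplx K n) (X' : cplx K n')
    (f : forall i, cT X i -> cT X' i) i j m :
  quasi_iso g f -> is_hdim X i j m <-> is_hdim X' i j m.
Proof.
move=> [cm inj surj]; apply: (is_dim_transfer (cm_lin cm (i:=i))).
- exact: cZ_sub.
- exact: cB_sub.
- by move=> u; apply: (cm_Z cm).
- by move=> u Zu; split; [apply: (cm_B cm) | apply: inj].
- exact: surj.
Qed.

(** * Twisted sums of complexes and the five lemma *)

Section Twist.
Variables (K : fieldType) (n : nat) (X2 X1 : cplx K n).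
Variable h : forall i, cT X1 i -> cT X2 i.-1.
Arguments h {i}.
Hypothesis h_lin : forall i, semilin id (@h i).
Hypothesis h_d : forall i (v : cT X1 i), cd (h v) + h (cd v) = 0.
Hypothesis h_C : forall i j (v : cT X1 i), cC j v -> cC j (h v).
Hypothesis h_N : forall i j (v : cT X1 i), cN j v -> cN j (h v).
Hypothesis h_0 : forall j (v : cT X1 0), cC j v -> h v = 0.

Definition twT i : lmodType {mpoly K[n]} := (cT X2 i * cT X1 i)%type.
Definition twd i (p : twT i) : twT i.-1 := (cd p.1 + h p.2, cd p.2).
Definition twC i j (p : twT i) := cC j p.1 /\ cC j p.2.
Definition twN i j (p : twT i) := cN j p.1 /\ cN j p.2.

(** X2 is a subcomplex with quotient X1. The differential squares to zero because [h] anticommutes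
    with d; if X1 is a shift with negated differential, this is a mapping cone. *)
Definition twist : cplx K n.
Proof.
refine (@Cplx K n twT twd twC twN _ _ _ _ _ _ _ _ _ _).
- move=> i a [u1 u2] [v1 v2]; rewrite /twd /= !cd_lin h_lin.
  by congr pair => /=; rewrite scalerDr; zmod.
- move=> i [u v]; rewrite /twd /= cdD !cdd; congr pair.
  by rewrite add0r h_d.
- by move=> j [u v] [/= Cu Cv]; rewrite /twd /= (h_0 Cv) !(cd_eq0 (j:=j)) ?addr0.
- move=> i j; split=> [|a u w [? ?] [? ?]]; first by split; apply: C0.
  by split; [case: (cC_sub X2 i j) | case: (cC_sub X1 i j)] => _; apply.
- move=> i j; split=> [|a u w [? ?] [? ?]]; first by split; apply: N0.
  by split; [case: (cN_sub X2 i j) | case: (cN_sub X1 i j)] => _; apply.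
- by move=> i j u [? ?]; split; apply: cNC.
- by move=> i j u [? ?]; split=> /=; [apply: CD; [apply: cCd|apply: h_C]|apply: cCd].
- by move=> i j u [? ?]; split=> /=; [apply: ND; [apply: cNd|apply: h_N]|apply: cNd].
- by move=> i j y u hy [? ?]; split; apply: cCy.
- by move=> i j y u hy [? ?]; split; apply: cNy.
Defined.

Lemma twhD i (u v : cT X1 i) : h (u + v) = h u + h v.
Proof. exact: (@semilinD _ _ _ _ _ idfun _ (@h_lin i)). Qed.
Lemma twhB i (u v : cT X1 i) : h (u - v) = h u - h v.
Proof. exact: (@semilinB _ _ _ _ _ idfun _ (@h_lin i)). Qed.
Lemma twhd i (v : cT X1 i) : h (cd v) = - cd (h v).
Proof. by apply/eqP; rewrite -addr_eq0 addrC h_d. Qed.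

End Twist.

Section TwistQuasiIso.
Variables (K : fieldType) (n n' : nat).
Variable g : {lrmorphism {mpoly K[n]} -> {mpoly K[n']}}.
Variables (X2 X1 : cplx K n) (h : forall i, cT X1 i -> cT X2 i.-1).
Variables (X2' X1' : cplx K n') (h' : forall i, cT X1' i -> cT X2' i.-1).
Hypotheses (h_lin : forall i, semilin id (@h i))
  (h_d : forall i (v : cT X1 i), cd (h v) + h (cd v) = 0)
  (h_C : forall i j (v : cT X1 i), cC j v -> cC j (h v))
  (h_N : forall i j (v : cT X1 i), cN j v -> cN j (h v))
  (h_0 : forall j (v : cT X1 0), cC j v -> h v = 0).
Hypotheses (h'_lin : forall i, semilin id (@h' i))
  (h'_d : forall i (v : cT X1' i), cd (h' v) + h' (cd v) = 0)
  (h'_C : forall i j (v : cT X1' i), cC j v -> cC j (h' v))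
  (h'_N : forall i j (v : cT X1' i), cN j v -> cN j (h' v))
  (h'_0 : forall j (v : cT X1' 0), cC j v -> h' v = 0).
Variables (f2 : forall i, cT X2 i -> cT X2' i) (f1 : forall i, cT X1 i -> cT X1' i).
Arguments f1 : clear implicits.
Arguments f2 : clear implicits.
Hypotheses (q2 : quasi_iso g f2) (q1 : quasi_iso g f1).
Hypothesis f_h : forall i (v : cT X1 i), f2 i.-1 (h v) = h' (f1 i v).

Local Notation X := (twist h_lin h_d h_C h_N h_0).
Local Notation X' := (twist h'_lin h'_d h'_C h'_N h'_0).
Local Notation hB := (twhB h_lin).
Local Notation hD := (twhD h_lin).
Local Notation hd := (twhd h_d).
Local Notation h'B := (twhB h'_lin).
Local Notation h'D := (twhD h'_lin).
Local Notation h'd := (twhd h'_d).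

Definition tw_map i (p : cT X i) : cT X' i := (f2 i p.1, f1 i p.2).

Lemma twist_chain_map : chain_map g tw_map.
Proof.
have [[cm2 _ _] [cm1 _ _]] := (q2, q1).
split=> [i a u v|i j [u v] [/= Cu Cv]|i j [u v] [/= Nu Nv]|i j [u v] [/= Cu Cv]].
- by rewrite /tw_map /= !(cm_lin cm2) !(cm_lin cm1).
- by split; [apply: (cmC cm2) | apply: (cmC cm1)].
- by split; [apply: (cmN cm2) | apply: (cmN cm1)].
split=> /=; last exact: (cm_d cm1).
by apply: (cN_eq (cm_d cm2 Cu)); rewrite (cmD cm2) f_h; zmod.
Qed.

(** The injectivity half of the five lemma, on representatives. *)
Lemma twist_inj i j (u : cT X i) : cZ j u -> cB j (tw_map u) -> cB j u.
Proof.
have [[cm2 inj2 _] [cm1 inj1 surj1]] := (q2, q1).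
case: u => u v [[/= Cu Cv] [/= Nu Nv]] [[/= Cu' Cv']].
move=> [[w2 w1] [/= Cw2 Cw1] [/= Nw2 Nw1]].
have [_ [t1 Ct1 Nt1]] : cB j v.
  by apply: inj1; [split | split=> //; exists w1].
have Nh1 : cN j (h v + cd (h t1)).
  by apply: (cN_eq (h_N Nt1)); rewrite hB (hd t1); zmod.
(* [w1] and the image of [t1] have the same boundary, so their difference is a cycle and comes from
   a cycle [z] up to a boundary. Then [t1 + z] is the right second component. *)
pose z' := w1 - f1 _ t1.
have Zz' : cZ j z'.
  split; first by apply: CB => //; apply: (cmC cm1).
  have := cmN cm1 Nt1; rewrite (cmB cm1) => N1.
  apply: (cN_eq (NB (ND (cm_d cm1 Ct1) N1) Nw1)).
  by rewrite /z' cdB; zmod.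
have [z [Cz Nz] [Cz2 [w3 Cw3 Nw3]]] := surj1 _ _ _ Zz'.
pose a := u - h t1 - h z.
have Ca : cC j a := CB (CB Cu (h_C Ct1)) (h_C Cz).
have [_ [t2 Ct2 Nt2]] : cB j a.
  apply: inj2.
    split=> //; have := h_N Nz; rewrite (hd z) => Nhz.
    apply: (cN_eq (NB (ND Nu Nhz) Nh1)).
    by rewrite /a !cdB; zmod.
  split; first exact: (cmC cm2).
  exists (w2 - h' w3); first exact: (CB Cw2 (h'_C Cw3)).
  have := h'_N Nw3; rewrite !h'B (h'd w3) -!f_h => N3.
  apply: (cN_eq (ND Nw2 N3)).
  by rewrite /a !(cmB cm2) cdB /z'; zmod.
split; first by split.
exists (t2, t1 + z); first by split=> //=; apply: CD.
split=> /=.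
  by apply: (cN_eq Nt2); rewrite /a hD; zmod.
by apply: (cN_eq (NB Nt1 Nz)); rewrite cdD; zmod.
Qed.

Lemma twist_surj i j (u' : cT X' i) :
  cZ j u' -> exists2 u, cZ j u & cB j (u' - @tw_map i u).
Proof.
have [[cm2 inj2 surj2] [cm1 inj1 surj1]] := (q2, q1).
case: u' => u' v' [[/= Cu' Cv'] [/= Nu' Nv']].
have [|v [Cv Nv] [C1 [w1 Cw1 Nw1]]] := surj1 i j v'; first by [].
have N1 := h'_N Nw1; rewrite !h'B (h'd w1) -f_h in N1.
(* [h v] must bound for v to extend to a cycle. Its image is the boundary of [h' w1 - u'], so
   injectivity of [f2] one degree lower applies. Degree 0 is separate: there [h v] vanishes
   outright. *)
have [t Ct Nt] : exists2 t : cT X2 i, cC j t & cN j (h v - cd t).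
  case: i u' v' v w1 Cu' Cv' Nu' Nv' Cv Nv C1 Cw1 Nw1 N1 => [|i].
    move=> _ _ v _ _ _ _ _ Cv _ _ _ _ _; exists 0; first exact: C0.
    by rewrite (h_0 Cv) cd0 subr0; apply: N0.
  move=> u' v' v w1 Cu' Cv' Nu' Nv' Cv Nv C1 Cw1 Nw1 N1.
  have [||_ [t Ct Nt]] := inj2 i j (h v); last by exists t.
  - split; first exact: (h_C Cv).
    by apply: (cN_eq (NN (h_N Nv))); rewrite (hd v); zmod.
  - split; first exact: (cmC cm2 (h_C Cv)).
    exists (h' w1 - u'); first exact: (CB (h'_C Cw1) Cu').
    by apply: (cN_eq (NB Nu' N1)); rewrite cdB; zmod.
pose u2 := u' + f2 i t - h' w1.
have Cu2 : cC j u2 := CB (CD Cu' (cmC cm2 Ct)) (h'_C Cw1).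
have Zu2 : cZ j u2.
  split=> //; have := cmN cm2 Nt; rewrite (cmB cm2) => N2.
  apply: (cN_eq (NB (NB (NB Nu' N1) N2) (cm_d cm2 Ct))).
  by rewrite /u2 cdB cdD; zmod.
have [u [Cu Nu] [C2 [w2 Cw2 Nw2]]] := surj2 _ _ _ Zu2.
exists (u - t, v).
  split; first by split=> //=; apply: CB.
  split=> //=; apply: (cN_eq (ND Nu Nt)).
  by rewrite cdB; zmod.
split.
  split=> //=; apply: CB => //; apply: (cmC cm2); exact: CB.
exists (w2, w1); first by split.
split=> //=; apply: (cN_eq Nw2).
by rewrite /u2 (cmB cm2); zmod.
Qed.

Lemma twist_quasi_iso : quasi_iso g tw_map.
Proof. split; [exact: twist_chain_map | exact: twist_inj | exact: twist_surj]. Qed.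

End TwistQuasiIso.

(** * Shifts, cones of linear forms and Koszul complexes *)

Section Shift.
Variables (K : fieldType) (n : nat) (X : cplx K n).

Definition lowered (T : lmodType {mpoly K[n]}) (P : nat -> T -> Prop) j (v : T) :=
  if j is j'.+1 then P j' v else v = 0.

Lemma lowered_sub (T : lmodType {mpoly K[n]}) (P : nat -> T -> Prop) j :
  (forall j, subsp (P j)) -> subsp (lowered P j).
Proof.
case: j => [|j] sP /=; last exact: sP.
by split=> // a u v -> ->; rewrite scaler0 addr0.
Qed.

(** Homological degree and internal degree both move by one. As [0.-1] is 0, the carrier in
    homological degree 0 is still [cT X 0], and its graded part is set to zero by hand. *)
Definition shC i j : cT X i.-1 -> Prop :=
  match i with
  | 0 => fun v => v = 0
  | i'.+1 => fun v => lowered (@cC _ _ X i') j v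
  end.

Definition shN i j : cT X i.-1 -> Prop :=
  match i with
  | 0 => fun v => v = 0
  | i'.+1 => fun v => lowered (@cN _ _ X i') j v
  end.

Lemma zero_sub (T : lmodType {mpoly K[n]}) : subsp (fun v : T => v = 0).
Proof. by split=> // a u v -> ->; rewrite scaler0 addr0. Qed.

Definition shift : cplx K n.
Proof.
refine (@Cplx K n (fun i => cT X i.-1) (fun i v => - cd v) shC shN
  _ _ _ _ _ _ _ _ _ _).
- by move=> i a u v; rewrite cd_lin opprD /= scalerN.
- by move=> i u; rewrite cdN opprK cdd.
- by move=> j u /= ->; rewrite cd0 oppr0.
- move=> [|i] j /=; first exact: zero_sub.
  by apply: lowered_sub => j'; apply: cC_sub.
- move=> [|i] j /=; first exact: zero_sub.
  by apply: lowered_sub => j'; apply: cN_sub.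
- by move=> [|i] [|j] u //=; apply: cNC.
- move=> [|[|i]] [|j] u /=; try by move=> ->; rewrite cd0 oppr0.
    by move=> /cd_eq0 ->; rewrite oppr0.
  by move=> Cu; apply: CN; apply: cCd Cu.
- move=> [|[|i]] [|j] u /=; try by move=> ->; rewrite cd0 oppr0.
    by move=> /cNC/cd_eq0 ->; rewrite oppr0.
  by move=> Nu; apply: NN; apply: cNd Nu.
- move=> [|i] [|j] y u hy /=; try by move=> ->; rewrite scaler0.
    by move=> ->; rewrite scaler0; apply: C0.
  exact: cCy.
- move=> [|i] [|j] y u hy /=; try by move=> ->; rewrite scaler0.
    by move=> ->; rewrite scaler0; apply: N0.
  exact: cNy.
Defined.

Lemma shift_Z i j (u : cT X i) : cZ (X := shift) (i := i.+1) j.+1 u <-> cZ j u.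
Proof.
split=> [[/= Cu Nu]|[Cu Nu]]; split=> //=.
- case: i u Cu Nu => [|i] u Cu /= Nu; first by rewrite (cd_eq0 Cu); apply: N0.
  by apply: (cN_eq (NN Nu)); rewrite opprK.
- case: i u Cu Nu => [|i] u Cu /= Nu; first by rewrite (cd_eq0 Cu) oppr0.
  exact: NN.
Qed.

Lemma shift_B i j (u : cT X i) : cB (X := shift) (i := i.+1) j.+1 u <-> cB j u.
Proof.
split=> [[Cu [w Cw Nw]]|[Cu [w Cw Nw]]]; split=> //; exists (- w).
- exact: (@CN K n X i.+1 j w Cw).
- by move: Nw; rewrite /= cdN.
- exact: (@CN K n X i.+1 j w Cw).
- by rewrite /= cdN opprK.
Qed.

Lemma shift_hdim i j m : is_hdim X i j m -> is_hdim shift i.+1 j.+1 m.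
Proof.
suff [h _] : is_hdim X i j m <-> is_hdim shift i.+1 j.+1 m by [].
apply: (@is_dim_transfer K n n (cT X i) (cT shift i.+1) idfun id).
- by move=> a u v.
- exact: cZ_sub.
- exact: cB_sub.
- by move=> u /shift_Z.
- by move=> u _; apply: iff_sym; apply: shift_B.
- move=> u /shift_Z Zu; exists u => //; rewrite subrr; apply: subsp0.
  exact: cB_sub.
Qed.

Lemma shift_hdim0 j : is_hdim shift 0 j 0.
Proof. by apply/is_dim0 => u [/= -> _]; apply: subsp0; apply: cB_sub. Qed.

End Shift.

Section ShiftQuasiIso.
Variables (K : fieldType) (n n' : nat).
Variable g : {lrmorphism {mpoly K[n]} -> {mpoly K[n']}}.
Variables (X : cplx K n) (X' : cplx K n') (f : forall i, cT X i -> cT X' i).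
Arguments f : clear implicits.
Hypothesis q : quasi_iso g f.

Definition sh_map i (u : cT (shift X) i) : cT (shift X') i := f i.-1 u.

Lemma shift_quasi_iso : quasi_iso g sh_map.
Proof.
have [cm inj surj] := q.
have f0 i : f i 0 = 0 by apply: (semilin0 (cm_lin cm (i:=i))).
have fN i u : f i (- u) = - f i u by apply: (semilinN (cm_lin cm (i:=i))).
split; first split.
- by move=> i a u v; rewrite /sh_map (cm_lin cm).
- by move=> [|i] [|j] u /=; try (by move=> ->; rewrite /sh_map f0); apply: (cmC cm).
- by move=> [|i] [|j] u /=; try (by move=> ->; rewrite /sh_map f0); apply: (cmN cm).
- move=> [|[|i]] [|j] u; rewrite /sh_map /=;
    try by move=> ->; rewrite !(f0, cd0, oppr0, addr0).
  + move=> Cu; rewrite fN (cd_eq0 Cu) (cd_eq0 (cmC cm Cu)).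
    by rewrite f0 !oppr0 addr0.
  + by move=> Cu; apply: (cN_eq (NN (cm_d cm Cu))); rewrite fN; zmod.
- move=> [|i] j u; first by move=> [/= -> _] _; apply: subsp0; apply: cB_sub.
  case: j => [|j]; first by move=> [/= -> _] _; apply: subsp0; apply: cB_sub.
  by move=> /shift_Z Zu /shift_B Bu; apply/shift_B; apply: inj.
- have triv i j (u' : cT (shift X') i) : u' = 0 ->
    exists2 u : cT (shift X) i, cZ j u & cB j (u' - sh_map u).
    move=> ->; exists 0; first exact: (subsp0 (cZ_sub (shift X) i j)).
    by rewrite /sh_map f0 subr0; exact: (subsp0 (cB_sub (shift X') i j)).
  move=> [|i] j u'; first by move=> [u0 _]; apply: (triv 0%N j u' u0).
  case: j => [|j]; first by move=> [u0 _]; apply: (triv i.+1 0%N u' u0).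
  move=> /shift_Z/surj[u Zu Bu]; exists u; first exact/shift_Z.
  exact/shift_B.
Qed.

End ShiftQuasiIso.

Section Cone.
Variables (K : fieldType) (n : nat) (y : {mpoly K[n]}) (X : cplx K n).

(** Taking the linear part of y makes the cone of y graded whatever y is. *)
Definition lpart (n : nat) (y : {mpoly K[n]}) := pihomog mdeg 1 y.

Lemma lpart_homog n' (z : {mpoly K[n']}) : lpart z \is 1.-homog.
Proof. exact: pihomogP. Qed.

Definition cone_h i (v : cT (shift X) i) : cT X i.-1 := lpart y *: v.

Lemma cone_h_lin i : semilin id (@cone_h i).
Proof. by move=> a u v; rewrite /cone_h scalerDr !scalerA mulrC. Qed.

Lemma cone_h_d i (v : cT (shift X) i) : cd (cone_h v) + cone_h (cd v) = 0.
Proof. by rewrite /cone_h /= cdZ scalerN subrr. Qed.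

Lemma cone_h_C i j (v : cT (shift X) i) : cC j v -> cC j (cone_h v).
Proof.
rewrite /cone_h; case: i j v => [|i] [|j] v /=;
  try by move=> ->; rewrite scaler0; apply: C0.
by apply: cCy; apply: lpart_homog.
Qed.

Lemma cone_h_N i j (v : cT (shift X) i) : cN j v -> cN j (cone_h v).
Proof.
rewrite /cone_h; case: i j v => [|i] [|j] v /=;
  try by move=> ->; rewrite scaler0; apply: N0.
by apply: cNy; apply: lpart_homog.
Qed.

Lemma cone_h_0 j (v : cT (shift X) 0) : cC j v -> cone_h v = 0.
Proof. by move=> /= ->; rewrite /cone_h scaler0. Qed.

(** The total complex of the Koszul complex of y tensored with X. *)
Definition cone : cplx K n :=
  twist cone_h_lin cone_h_d cone_h_C cone_h_N cone_h_0.

End Cone.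

Fixpoint koszul (K : fieldType) (n : nat) (ys : seq {mpoly K[n]}) (X : cplx K n) :=
  if ys is y :: ys' then koszul ys' (cone y X) else X.

Lemma cone_quasi_iso (K : fieldType) (n n' : nat)
    (g : {lrmorphism {mpoly K[n]} -> {mpoly K[n']}}) (X : cplx K n) (X' : cplx K n')
    (f : forall i, cT X i -> cT X' i) y :
  g (lpart y) = lpart (g y) -> quasi_iso g f ->
  exists f' : forall i, cT (cone y X) i -> cT (cone (g y) X') i, quasi_iso g f'.
Proof.
move=> gy q; have [cm _ _] := q.
eexists; apply: (twist_quasi_iso _ _ _ _ _ _ _ _ _ _ q (shift_quasi_iso q)).
by move=> i v; rewrite /cone_h /sh_map -gy; apply: (semilinZ (cm_lin cm (i:=i.-1))).
Qed.

(** Each cone preserves quasi-isomorphisms, so a complex may be replaced by a quasi-isomorphic one,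
    even over another ring, underneath all remaining forms. *)
Lemma koszul_hdim (K : fieldType) (n n' : nat)
    (g : {lrmorphism {mpoly K[n]} -> {mpoly K[n']}}) (X : cplx K n) (X' : cplx K n')
    (f : forall i, cT X i -> cT X' i) ys i j m :
  (forall y, g (lpart y) = lpart (g y)) -> quasi_iso g f ->
  is_hdim (koszul ys X) i j m <-> is_hdim (koszul (map g ys) X') i j m.
Proof.
move=> gl; elim: ys X X' f => [|y ys IH] X X' f q /=; first exact: quasi_iso_hdim q.
by have [f' q'] := cone_quasi_iso (gl y) q; apply: IH q'.
Qed.

Section ConeQuotient.
Variables (K : fieldType) (n n' : nat).
Variable g : {lrmorphism {mpoly K[n]} -> {mpoly K[n']}}.
Variables (X : cplx K n) (X' : cplx K n') (f : forall i, cT X i -> cT X' i).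
Arguments f : clear implicits.
Variable y : {mpoly K[n]}.
Hypothesis cm : chain_map g f.
Hypothesis y_inj : forall i j (u : cT X i),
  cC j u -> cN j.+1 (lpart y *: u) -> cN j u.
Hypothesis f_y : forall i j (u : cT X i), cC j u -> cN j.+1 (f i (lpart y *: u)).
Hypothesis f_onto : forall i j (u' : cT X' i),
  cC j u' -> exists2 u, cC j u & cN j (u' - f i u).
Hypothesis f_ker : forall i j (u : cT X i), cC j u -> cN j (f i u) ->
  exists2 c, lowered (@cC _ _ X i) j c & cN j (u - lpart y *: c).

Definition cone_quot_map i (p : cT (cone y X) i) : cT X' i := f i p.1.

Lemma lowered_y_inj i j (c : cT X i) : lowered (@cC _ _ X i) j c ->
  cN j (lpart y *: c) -> lowered (@cN _ _ X i) j c.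
Proof. by case: j => // j; apply: y_inj. Qed.

Lemma lowered_d i j (c : cT X i) : lowered (@cC _ _ X i) j c ->
  lowered (@cC _ _ X i.-1) j (cd c).
Proof. by case: j => [/= ->|j /=]; [rewrite cd0 | apply: cCd]. Qed.

Lemma lowered_d0 j (c : cT X 0) : lowered (@cC _ _ X 0) j c -> cd c = 0.
Proof. by case: j => [/= ->|j /=]; [rewrite cd0 | apply: cd_eq0]. Qed.

(** X' plays the role of X/yX. Since y is injective modulo [cN], the second component of a cycle in
    the cone is determined up to [cN] by the first: it is minus the quotient of the boundary by
    y. *)
Lemma cone_quotient : quasi_iso g cone_quot_map.
Proof.
rewrite /cone_quot_map; split; first split.
- by move=> i a [u1 u2] [v1 v2]; apply: (cm_lin cm).
- by move=> i j [u v] [/= Cu _]; apply: (cmC cm).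
- by move=> i j [u v] [/= Nu _]; apply: (cmN cm).
- move=> i j [u v] [/= Cu Cv].
  have N1 : cN j (f i.-1 (cone_h y v)).
    rewrite /cone_h; case: i j u v Cu Cv => [|i] [|j] u v _ /=;
      try by move=> ->; rewrite scaler0 (semilin0 (cm_lin cm (i:=_))); apply: N0.
    exact: f_y.
  apply: (cN_eq (ND (cm_d cm Cu) N1)).
  by rewrite (cmD cm); zmod.
- move=> i j [u v] [[/= Cu Cv] [/= Nu Nv]] [C1 [w' Cw' Nw']].
  have [w Cw Nw] := f_onto Cw'.
  have N1 : cN j (f i (u - cd w)).
    apply: (cN_eq (ND (NB Nw' (cm_d cm Cw)) (cNd Nw))).
    by rewrite (cmB cm) cdB; zmod.
  (* [u - cd w] vanishes in the quotient, hence is a multiple of y; [(w, c)] then bounds [(u, v)],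
     the second components being compared after multiplication by y. *)
  have [c Cc Nc] := f_ker (CB Cu (cCd Cw)) N1.
  split; first by [].
  exists (w, c); first by split.
  split=> /=; first by apply: (cN_eq Nc); rewrite /cone_h; zmod.
  rewrite opprK.
  case: i u v Cu Cv Nu Nv C1 w' Cw' Nw' w Cw Nw N1 c Cc Nc => [|i] u v Cu Cv.
    move=> _ _ _ _ _ _ _ _ _ _ c Cc _.
    by rewrite (lowered_d0 Cc) addr0.
  move=> Nu Nv _ _ _ _ w Cw _ _ c Cc Nc.
  apply: lowered_y_inj.
    apply: subspD => //; first by apply: lowered_sub => j'; apply: cC_sub.
    exact: (lowered_d Cc).
  have := cNd Nc; rewrite !cdB (cdd w) cdZ => N2.
  by apply: (cN_eq (NB Nu N2)); rewrite /cone_h scalerDr; zmod.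
- move=> i j u' [Cu' Nu']; have [u Cu Nu] := f_onto Cu'.
  have [c Cc [Nc Ndc]] : exists2 c, @shC _ _ X i j c &
      cN j (cd u - lpart y *: c) /\ @shN _ _ X i.-1 j (cd c).
    have N1 : cN j (f _ (cd u)).
      apply: (cN_eq (ND (NB Nu' (cNd Nu)) (cm_d cm Cu))).
      by rewrite cdB; zmod.
    case: i u' Cu' Nu' u Cu Nu N1 => [|i] u' Cu' Nu' u Cu Nu N1.
      exists 0 => //; rewrite (cd_eq0 Cu) scaler0 subr0 cd0.
      by split; first exact: N0.
    have [c Cc Nc] := f_ker (cCd Cu) N1; exists c => //; split=> //.
    case: i u' Cu' Nu' u Cu Nu N1 c Cc Nc => [|i] u' Cu' Nu' u Cu Nu N1 c Cc Nc.
      exact: (lowered_d0 Cc).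
    apply: lowered_y_inj; first exact: (lowered_d Cc).
    have := cNd Nc; rewrite cdB (cdd u) cdZ => N2.
    by apply: (cN_eq (NN N2)); zmod.
  exists (u, - c).
    split; first by split=> //; apply: (@CN _ _ (shift X) i j).
    split=> /=; first by apply: (cN_eq Nc); rewrite /cone_h scalerN; zmod.
    by rewrite cdN opprK.
  split; first by apply: CB => //; apply: (cmC cm).
  by exists 0; [apply: C0|rewrite cd0 subr0].
Qed.

End ConeQuotient.

(** * Direct sums and trivial actions *)

Record strict_map (K : fieldType) (n : nat) (X X' : cplx K n)
    (e : forall i, cT X i -> cT X' i) : Prop := StrictMap {
  sm_lin : forall i, semilin id (e i);
  sm_d : forall i (u : cT X i), e i.-1 (cd u) = cd (e i u);
  smC : forall i j (u : cT X i), cC j u -> cC j (e i u);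
  smN : forall i j (u : cT X i), cN j u -> cN j (e i u)
}.

Section StrictMap.
Variables (K : fieldType) (n : nat) (X X' : cplx K n).
Variables (e : forall i, cT X i -> cT X' i).
Arguments e : clear implicits.
Hypothesis sm : strict_map e.

Lemma smD i u v : e i (u + v) = e i u + e i v.
Proof. exact: (@semilinD _ _ _ _ _ idfun _ (sm_lin sm (i:=i))). Qed.
Lemma smB i u v : e i (u - v) = e i u - e i v.
Proof. exact: (@semilinB _ _ _ _ _ idfun _ (sm_lin sm (i:=i))). Qed.
Lemma smZ i a u : e i (a *: u) = a *: e i u.
Proof. exact: (@semilinZ _ _ _ _ _ idfun _ (sm_lin sm (i:=i))). Qed.
Lemma sm0 i : e i 0 = 0.
Proof. exact: (@semilin0 _ _ _ _ _ idfun _ (sm_lin sm (i:=i))). Qed.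

End StrictMap.

(** An internal direct sum of the quotients of [cC] by [cN]: components exist on representatives and
    are unique up to [cN]. *)
Definition direct_sum (K : fieldType) (n : nat) (X1 X2 X : cplx K n) : Prop :=
  exists (e1 : forall i, cT X1 i -> cT X i) (e2 : forall i, cT X2 i -> cT X i),
  [/\ strict_map e1, strict_map e2,
    forall i j (u : cT X i), cC j u ->
      exists u1 u2, [/\ cC j u1, cC j u2 & u = e1 i u1 + e2 i u2]
  & forall i j u1 u2, cC j u1 -> cC j u2 -> cN j (e1 i u1 + e2 i u2) ->
      cN j u1 /\ cN j u2].

Section DirectSum.
Variables (K : fieldType) (n : nat) (X1 X2 X : cplx K n).
Hypothesis ds : direct_sum X1 X2 X.

Lemma direct_sum_cone y : direct_sum (cone y X1) (cone y X2) (cone y X).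
Proof.
have [e1 [e2 [s1 s2 dec inj]]] := ds.
have sm (X0 : cplx K n) (e : forall i, cT X0 i -> cT X i) : strict_map e ->
    @strict_map K n (cone y X0) (cone y X) (fun i p => (e i p.1, e i.-1 p.2)).
  move=> s; split=> [i a u v|i u|i j u [Cu Cv]|i j u [Nu Nv]].
  - by rewrite /= !(sm_lin s).
  - rewrite /= /twd /= /cone_h (smD s) !(sm_d s) (smZ s); congr pair.
    by rewrite -!scaleN1r (smZ s) (sm_d s).
  - split; first exact: (smC s).
    case: i j u Cu Cv => [|i] [|j] u _ /=; try (by move=> ->; rewrite (sm0 s)).
    exact: (smC s).
  - split; first exact: (smN s).
    case: i j u Nu Nv => [|i] [|j] u _ /=; try (by move=> ->; rewrite (sm0 s)).
    exact: (smN s).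
exists (fun i p => (e1 i p.1, e1 i.-1 p.2)), (fun i p => (e2 i p.1, e2 i.-1 p.2)).
split; try exact: sm.
- move=> i j [u v] [/= Cu Cv]; have [u1 [u2 [C1 C2 ->]]] := dec _ _ _ Cu.
  have [v1 [v2 [D1 D2 ->]]] : exists v1 v2, [/\ @shC _ _ X1 i j v1,
      @shC _ _ X2 i j v2 & v = e1 i.-1 v1 + e2 i.-1 v2].
    case: i j v {u u1 u2 Cu C1 C2} Cv => [|i] [|j] v /=;
      try (by move=> ->; exists 0, 0; rewrite (sm0 s1) (sm0 s2) addr0).
    exact: dec.
  by exists (u1, v1), (u2, v2).
- move=> i j [u1 v1] [u2 v2] [/= C1 D1] [/= C2 D2] [/= Nu Nv].
  have [N1 N2] := inj _ _ _ _ C1 C2 Nu.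
  have [M1 M2] : @shN _ _ X1 i j v1 /\ @shN _ _ X2 i j v2.
    case: i j {u1 u2 C1 C2 Nu N1 N2} v1 v2 D1 D2 Nv => [|i] [|j] v1 v2 //=.
    exact: inj.
  by split; split.
Qed.

Lemma direct_sum_hdim i j m1 m2 :
  is_hdim X1 i j m1 -> is_hdim X2 i j m2 -> is_hdim X i j (m1 + m2).
Proof.
have [e1 [e2 [s1 s2 dec inj]]] := ds.
apply: (is_dim_sum (sm_lin s1 (i:=i)) (sm_lin s2 (i:=i))).
- exact: cZ_sub.
- exact: cZ_sub.
- move=> u1 u2 [C1 N1] [C2 N2]; split.
    by apply: CD; [apply: (smC s1) | apply: (smC s2)].
  by rewrite cdD -(sm_d s1) -(sm_d s2); apply: ND; [apply: (smN s1)|apply: (smN s2)].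
- move=> z [Cz Nz]; have [u1 [u2 [C1 C2 e]]] := dec _ _ _ Cz.
  exists u1, u2; rewrite e cdD -(sm_d s1) -(sm_d s2) in Nz *.
  by have [N1 N2] := inj _ _ _ _ (cCd C1) (cCd C2) Nz.
- move=> u1 u2 [C1 _] [C2 _]; split=> [[_ [w Cw Nw]]|[[_ [w1 Cw1 N1]] [_ [w2 Cw2 N2]]]].
    have [w1 [w2 [Cw1 Cw2 e]]] := dec _ _ _ Cw.
    have [|||N1 N2] := inj i j (u1 - cd w1) (u2 - cd w2).
    - exact: (CB C1 (cCd Cw1)).
    - exact: (CB C2 (cCd Cw2)).
    - apply: (cN_eq Nw); rewrite e cdD -(sm_d s1) -(sm_d s2) (smB s1) (smB s2); zmod.
    by split; split=> //; [exists w1 | exists w2].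
  split; first by apply: CD; [apply: (smC s1) | apply: (smC s2)].
  exists (e1 _ w1 + e2 _ w2); first by apply: CD; [apply: (smC s1) | apply: (smC s2)].
  apply: (cN_eq (ND (smN s1 N1) (smN s2 N2))).
  by rewrite cdD -(sm_d s1) -(sm_d s2) (smB s1) (smB s2); zmod.
Qed.

End DirectSum.

Lemma direct_sum_koszul (K : fieldType) (n : nat) (X1 X2 X : cplx K n) ys i j m1 m2 :
  direct_sum X1 X2 X -> is_hdim (koszul ys X1) i j m1 ->
  is_hdim (koszul ys X2) i j m2 -> is_hdim (koszul ys X) i j (m1 + m2).
Proof.
elim: ys X1 X2 X => [|y ys IH] X1 X2 X ds /=; first exact: direct_sum_hdim.
by apply: IH; apply: direct_sum_cone.
Qed.

Definition trivial_action (K : fieldType) (n : nat) (X : cplx K n) :=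
  forall i j (y : {mpoly K[n]}) (u : cT X i),
    y \is 1.-homog -> cC j u -> cN j.+1 (y *: u).

Section TrivialAction.
Variables (K : fieldType) (n : nat) (X : cplx K n).
Hypothesis tX : trivial_action X.

Lemma trivial_cone y : trivial_action (cone y X).
Proof.
move=> i j z [u v] hz [/= Cu Cv]; split=> /=; first exact: tX.
case: i j v {u Cu} Cv => [|i] [|j] v /=; try by move=> ->; rewrite scaler0.
  by move=> ->; rewrite scaler0; apply: N0.
exact: tX.
Qed.

(** The off-diagonal term of the cone differential is zero modulo [cN], so the cone is X plus its
    shift. *)
Lemma trivial_cone_hdim y i j m m' :
  is_hdim X i j m -> is_hdim (shift X) i j m' -> is_hdim (cone y X) i j (m + m').
Proof.
have Nh i0 j0 (v : cT (shift X) i0) : cC j0 v -> cN j0 (cone_h y v).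
  rewrite /cone_h; case: i0 j0 v => [|i0] [|j0] v /=;
    try by move=> ->; rewrite scaler0; apply: N0.
  by apply: tX; apply: lpart_homog.
apply: (@is_dim_sum K n (cT X i) (cT (shift X) i) (cT (cone y X) i)
  (fun u => (u, 0)) (fun v => (0, v))).
- by move=> a u v; congr pair; rewrite /= scaler0 addr0.
- by move=> a u v; congr pair; rewrite /= scaler0 addr0.
- exact: cZ_sub.
- exact: cZ_sub.
- move=> u v [Cu Nu] [Cv Nv]; split; split=> //=; rewrite ?addr0 ?add0r //.
  by apply: ND => //; apply: Nh.
- move=> [u v] [[/= Cu Cv] [/= Nu Nv]]; exists u, v; split=> //.
    by split=> //; apply: (cN_eq (NB Nu (Nh _ _ _ Cv))); zmod.
  by congr pair; rewrite ?addr0 ?add0r.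
- move=> u v [Cu Nu] [Cv Nv]; rewrite /cB; split.
    move=> [[/= _ _] [[w w'] [/= Cw Cw'] [/= N1 N2]]].
    rewrite ?addr0 ?add0r in N1 N2; split; split=> //; last by exists w'.
    exists w => //; apply: (cN_eq (ND N1 (Nh i.+1 j w' Cw'))); zmod.
  move=> [[_ [w Cw N1]] [_ [w' Cw' N2]]]; split.
    by split=> /=; rewrite ?addr0 ?add0r.
  exists (w, w'); first by split.
  split=> /=; rewrite ?addr0 ?add0r //.
  by apply: (cN_eq (NB N1 (Nh i.+1 j w' Cw'))); zmod.
Qed.

End TrivialAction.

(** Each cone adds a copy shifted by one in both degrees, so Pascal's rule governs the dimensions;
    writing the internal degree as [i + j] keeps j fixed under the shift. The parameter p counts the
    forms already used. *)
Lemma trivial_koszul (K : fieldType) (n : nat) (X : cplx K n) ys p s :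
  trivial_action X -> (forall i j, is_hdim X i (i + j) ('C(p, i) * s j)%N) ->
  forall i j, is_hdim (koszul ys X) i (i + j) ('C(size ys + p, i) * s j)%N.
Proof.
elim: ys X p => [|y ys IH] X p tX hX //= i j; rewrite addSnnS.
apply: IH; first exact: trivial_cone.
move=> {}i {}j; case: i => [|i].
  have := trivial_cone_hdim tX y (hX 0%N j) (shift_hdim0 X (0 + j)).
  by rewrite !bin0 addn0.
rewrite binS mulnDl; apply: trivial_cone_hdim => //.
by rewrite addSn; apply: shift_hdim.
Qed.

(** * Graded pieces of modules *)

Section HomogeneousParts.
Variables (K : fieldType) (n : nat).
Implicit Types p q : {mpoly K[n]}.
Local Notation pi := (pihomog mdeg).

Lemma pihomog_homog d e p : p \is d.-homog -> pi e p = if d == e then p else 0.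
Proof.
move=> hp; case: eqP => [<-|/eqP ne]; first exact: pihomog_dE.
exact: pihomog_ne0 hp.
Qed.

Lemma pihomog_split p : p = \sum_(d < msize p) pi d p.
Proof. exact: pihomog_partitionE. Qed.

Lemma homog_uniq d e p : p \is d.-homog -> p \is e.-homog -> d != e -> p = 0.
Proof.
by move=> /(pihomog_homog e) h /pihomog_dE h' /negbTE ne; rewrite -h' h ne.
Qed.

Lemma pihomogM d e p q : q \is d.-homog ->
  pi e (p * q) = if (d <= e)%N then pi (e - d) p * q else 0.
Proof.
move=> hq.
have homM k : pi k p * q \is (k + d).-homog by apply: dhomogM => //; apply: pihomogP.
rewrite {1}[p]pihomog_split mulr_suml raddf_sum /=.
under eq_bigr => k _ do rewrite (pihomog_homog e (homM k)).
case: leqP => hde; last first.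
  by rewrite big1 // => k _; case: eqP => // h; move: hde; rewrite -h ltnNge leq_addl.
case: (ltnP (e - d) (msize p)) => hs.
  rewrite (bigD1 (Ordinal hs)) //= subnK // eqxx big1 ?addr0 // => k.
  rewrite -val_eqE /= => /negbTE ne; case: eqP => // h; move: ne.
  by rewrite -h addnK eqxx.
rewrite big1 => [|k _]; last first.
  case: eqP => // h; move: (ltn_ord k); rewrite -{1}(addnK d k) h ltnNge hs //.
suff -> : pi (e - d) p = 0 by rewrite mul0r.
rewrite {1}[p]pihomog_split raddf_sum /= big1 // => k _.
rewrite (pihomog_homog _ (pihomogP _ _ _)); case: eqP => // h.
by move: (ltn_ord k); rewrite h ltnNge hs.
Qed.

(** p is homogeneous of degree j in the shifted module R(- e). *)
Definition hdeg (e j : nat) p : bool :=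
  if (e <= j)%N then p \is (j - e)%N.-homog else p == 0.

Definition hcomp (e j : nat) p : {mpoly K[n]} :=
  if (e <= j)%N then pi (j - e) p else 0.

Lemma hcompP e j p : hdeg e j (hcomp e j p).
Proof. by rewrite /hdeg /hcomp; case: leqP => // _; apply: pihomogP. Qed.

Lemma hcomp_id e j p : hdeg e j p -> hcomp e j p = p.
Proof. by rewrite /hdeg /hcomp; case: leqP => _; [apply: pihomog_dE|move/eqP]. Qed.

Lemma hcomp_sum e j (I : Type) (r : seq I) (F : I -> {mpoly K[n]}) :
  hcomp e j (\sum_(i <- r) F i) = \sum_(i <- r) hcomp e j (F i).
Proof. by rewrite /hcomp; case: ifP => _; [rewrite raddf_sum | rewrite big1]. Qed.

Lemma hcompM e f j p q : hdeg f e q -> hcomp f j (p * q) = hcomp e j p * q.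
Proof.
rewrite /hdeg /hcomp; case: (leqP f e) => [hfe hq|_ /eqP ->]; last first.
  by rewrite !mulr0; case: ifP => // _; rewrite pihomog0.
rewrite (pihomogM _ _ hq); case: (leqP e j) => hej.
  by rewrite (leq_trans hfe hej) leq_sub2r // subnBA // subnK // (leq_trans hfe hej).
rewrite mul0r; case: (leqP f j) => // hfj.
by rewrite leqNgt ltn_sub2r ?mul0r // (leq_ltn_trans hfj hej).
Qed.

Lemma hdeg_lin e j (a : K) p q : hdeg e j p -> hdeg e j q -> hdeg e j (a%:MP * p + q).
Proof.
rewrite /hdeg; case: leqP => _; last by move=> /eqP -> /eqP ->; rewrite mulr0 addr0.
by move=> hp hq; apply: rpredD => //; rewrite mul_mpolyC; apply: rpredZ.
Qed.

Lemma hdeg0 e j : hdeg e j 0.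
Proof. by rewrite /hdeg; case: leqP => _; rewrite ?rpred0. Qed.

Lemma hdegMy e j (y : {mpoly K[n]}) p :
  y \is 1.-homog -> hdeg e j p -> hdeg e j.+1 (y * p).
Proof.
rewrite /hdeg => hy; case: (leqP e j) => [h|h /eqP ->]; last first.
  by rewrite mulr0; case: ifP; rewrite ?rpred0.
by rewrite leqW // => hp; rewrite subSn // -add1n; apply: dhomogM.
Qed.

End HomogeneousParts.

Section GradedMorphism.
Variables (K : fieldType) (n n' : nat).
Variable phi : {lrmorphism {mpoly K[n]} -> {mpoly K[n']}}.
Hypothesis phi_homog : forall d p, p \is d.-homog -> phi p \is d.-homog.

Lemma phi_pihomog d p : phi (pihomog mdeg d p) = pihomog mdeg d (phi p).
Proof.
rewrite {2}[p]pihomog_split [phi (\sum_(_ < _) _)]raddf_sum [RHS]raddf_sum /=.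
under eq_bigr => k _ do
  rewrite (pihomog_homog d (phi_homog (pihomogP mdeg k p))).
case: (ltnP d (msize p)) => h.
  rewrite (bigD1 (Ordinal h)) //= eqxx big1 ?addr0 // => k.
  by rewrite -val_eqE /= => /negbTE ->.
rewrite big1 => [|k _].
  suff -> : pihomog mdeg d p = 0 by rewrite raddf0.
  rewrite {1}[p]pihomog_split raddf_sum /= big1 // => k _.
  rewrite (pihomog_homog _ (pihomogP _ _ _)); case: eqP => // e.
  by move: (ltn_ord k); rewrite e ltnNge h.
by case: eqP => // e; move: (ltn_ord k); rewrite e ltnNge h.
Qed.

Lemma phi_lpart y : phi (lpart y) = lpart (phi y).
Proof. exact: phi_pihomog. Qed.

Lemma phi_hcomp e j p : phi (hcomp e j p) = hcomp e j (phi p).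
Proof. by rewrite /hcomp; case: ifP => _; rewrite ?raddf0 ?phi_pihomog. Qed.

Lemma mcoeff0_pihomog m (p : {mpoly K[m]}) : p@_0%MM = (pihomog mdeg 0 p)@_0%MM.
Proof.
rewrite {1}[p]pihomog_split raddf_sum /=.
case: (ltnP 0 (msize p)) => h.
  rewrite (bigD1 (Ordinal h)) //= big1 ?addr0 // => k; rewrite -val_eqE /= => ne.
  apply: (dhomog_nemf_coeff (pihomogP mdeg k p)).
  by rewrite /= mdeg0 eq_sym.
move: h; rewrite leqn0 msize_poly_eq0 => /eqP ->.
by rewrite msize0 big_ord0 raddf0 mcoeff0.
Qed.

Lemma homog0_const m (p : {mpoly K[m]}) : p \is 0.-homog -> p = (p@_0%MM)%:MP.
Proof.
move=> hp; apply/mpolyP => k; rewrite mcoeffC; case: eqP => [->|/eqP ne].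
  by rewrite mulr1.
rewrite mulr0; apply: (dhomog_nemf_coeff hp).
by rewrite /= mdeg_eq0.
Qed.

Lemma phi_mcoeff0 p : (phi p)@_0%MM = p@_0%MM.
Proof.
rewrite mcoeff0_pihomog -phi_pihomog (homog0_const (pihomogP mdeg 0 p)).
by rewrite lrmorph_mpolyC mcoeffC eqxx mulr1 -mcoeff0_pihomog.
Qed.

End GradedMorphism.

(** * Graded modules and graded free modules as complexes *)

Section Concentrated.
Variables (K : fieldType) (n : nat).
Local Notation R := {mpoly K[n]}.

Record graded_pair (P Q : nat -> R^o -> Prop) : Prop := GradedPair {
  gpP : forall j, subsp (P j);
  gpQ : forall j, subsp (Q j);
  gp_sub : forall j p, Q j p -> P j p;
  gpPy : forall j (y p : R), y \is 1.-homog -> P j p -> P j.+1 (y * p);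
  gpQy : forall j (y p : R), y \is 1.-homog -> Q j p -> Q j.+1 (y * p)
}.

Variables (P Q : nat -> R^o -> Prop).

Definition concC (S : nat -> R^o -> Prop) (i j : nat) (p : R^o) : Prop :=
  if i is 0 then S j p else p = 0.

Lemma concC_sub S i j : (forall j, subsp (S j)) -> subsp (concC S i j).
Proof. by case: i => [|i] // _; apply: zero_sub. Qed.

(** The graded module P / Q placed in homological degree 0. *)
Definition concentrated (gp : graded_pair P Q) : cplx K n.
Proof.
refine (@Cplx K n (fun _ => R^o) (fun _ _ => 0) (concC P) (concC Q)
  _ _ _ _ _ _ _ _ _ _).
- by move=> i a u v; rewrite scaler0 addr0.
- by [].
- by [].
- by move=> i j; apply: concC_sub; apply: (gpP gp).
- by move=> i j; apply: concC_sub; apply: (gpQ gp).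
- by move=> [|i] j u //=; apply: (gp_sub gp).
- by move=> i j u _; apply: subsp0; apply: concC_sub; apply: (gpP gp).
- by move=> i j u _; apply: subsp0; apply: concC_sub; apply: (gpQ gp).
- move=> [|i] j y u hy /=; first exact: (gpPy gp).
  by move=> ->; rewrite scaler0.
- move=> [|i] j y u hy /=; first exact: (gpQy gp).
  by move=> ->; rewrite scaler0.
Defined.

Variable gp : graded_pair P Q.
Local Notation X := (concentrated gp).

Lemma conc_Z0 j (p : R^o) : cZ (X := X) (i := 0) j p <-> P j p.
Proof.
by split=> [[]|Pp] //; split=> //; apply: (subsp0 (gpQ gp j)).
Qed.

Lemma conc_B0 j (p : R^o) : P j p -> cB (X := X) (i := 0) j p <-> Q j p.
Proof.
move=> Pp; split=> [[_ [w _]]|Qp]; first by rewrite /= subr0.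
by split=> //; exists 0; rewrite /= ?subr0.
Qed.

Lemma conc_hdim0 j m : is_dim (P j) (Q j) m -> is_hdim X 0 j m.
Proof.
suff [h _] : is_dim (P j) (Q j) m <-> is_hdim X 0 j m by [].
apply: (@is_dim_transfer K n n R^o (cT X 0) idfun id) => //.
- exact: (gpP gp).
- exact: cB_sub.
- by move=> u Pu; apply/conc_Z0.
- by move=> u Pu; apply: iff_sym; apply: conc_B0.
- move=> u /conc_Z0 Pu; exists u => //; rewrite subrr; apply: subsp0.
  exact: cB_sub.
Qed.

Lemma conc_hdimS i j : is_hdim X i.+1 j 0.
Proof. by apply/is_dim0 => p [/= -> _]; apply: (subsp0 (cB_sub X i.+1 j)). Qed.

End Concentrated.

Lemma conc_quasi_iso (K : fieldType) (n n' : nat)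
    (g : {lrmorphism {mpoly K[n]} -> {mpoly K[n']}})
    (P Q : nat -> {mpoly K[n]}^o -> Prop) (P' Q' : nat -> {mpoly K[n']}^o -> Prop)
    (gp : graded_pair P Q) (gp' : graded_pair P' Q') :
  (forall j p, P j p -> P' j (g p)) -> (forall j p, P j p -> Q j p <-> Q' j (g p)) ->
  (forall j p', P' j p' -> exists2 p, P j p & Q' j (p' - g p)) ->
  @quasi_iso K n n' g (concentrated gp) (concentrated gp') (fun=> g).
Proof.
move=> gP gQ onto; split; first split.
- by move=> i a u v; rewrite raddfD /= rmorphM.
- by move=> [|i] j u /=; [apply: gP | move=> ->; rewrite raddf0].
- move=> [|i] j u /=; last by move=> ->; rewrite raddf0.
  by move=> Qu; apply/gQ => //; apply: (gp_sub gp).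
- by move=> i j u _; rewrite /= raddf0 subr0; apply: (N0 (concentrated gp') i.-1 j).
- move=> [|i] j u; last by move=> [/= -> _] _; apply: (subsp0 (cB_sub _ i.+1 j)).
  move=> /conc_Z0 Pu; rewrite (conc_B0 gp' (gP _ _ Pu)) -gQ // => Qu.
  exact/(conc_B0 gp).
- move=> [|i] j u'.
    move=> /conc_Z0/onto[u Pu Qu]; exists u; first exact/conc_Z0.
    exact: (proj2 (conc_B0 gp' (gp_sub gp' Qu))).
  move=> [/= -> _]; exists 0.
    exact: (subsp0 (cZ_sub (concentrated gp) i.+1 j)).
  by rewrite raddf0 subr0; apply: (subsp0 (cB_sub (concentrated gp') i.+1 j)).
Qed.

Section FreeComplex.
Variables (K : fieldType) (n : nat) (G : graded_free_data K n).
Local Notation R := {mpoly K[n]}.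

(** Only the complex property is recorded, since exactness can be lost when linear forms are divided
    out one after the other. *)
Record free_complex : Prop := FreeComplex {
  fc_hom : forall i a b, hdeg (gdeg b) (gdeg a) (gdiff G i a b);
  fc_dd : forall i, gdiff G i.+1 *m gdiff G i = 0
}.

Definition freeC i j (v : 'rV[R]_(grank G i)) : Prop :=
  forall a, hdeg (gdeg a) j (v 0 a).

Definition freed i : 'rV[R]_(grank G i) -> 'rV[R]_(grank G i.-1) :=
  match i with
  | 0 => fun=> 0
  | i'.+1 => fun v => v *m gdiff G i'
  end.

Definition hrow i j (v : 'rV[R]_(grank G i)) : 'rV[R]_(grank G i) :=
  \row_a hcomp (gdeg a) j (v 0 a).

Lemma hrowP i j (v : 'rV[R]_(grank G i)) : freeC j (hrow j v).
Proof. by move=> a; rewrite mxE hcompP. Qed.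

Lemma hrow_id i j (v : 'rV[R]_(grank G i)) : freeC j v -> hrow j v = v.
Proof. by move=> Cv; apply/rowP => a; rewrite mxE hcomp_id. Qed.

Lemma freeC_sub i j : subsp (@freeC i j).
Proof.
split=> [a|c u v Cu Cv a]; first by rewrite mxE hdeg0.
by rewrite !mxE; apply: hdeg_lin.
Qed.

Variable fc : free_complex.

(** Preimages under the differential, found without regard to degree, can thus be made
    homogeneous. *)
Lemma hrow_d i j (v : 'rV[R]_(grank G i.+1)) :
  hrow j v *m gdiff G i = hrow j (v *m gdiff G i).
Proof.
apply/rowP => b; rewrite !mxE hcomp_sum; apply: eq_bigr => a _.
by rewrite mxE (hcompM _ _ (fc_hom fc a b)).
Qed.

Lemma freeC_d i j (v : 'rV[R]_(grank G i)) : freeC j v -> freeC j (freed v).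
Proof.
case: i v => [|i] v Cv; first exact: (subsp0 (freeC_sub 0 j)).
by rewrite /= -(hrow_id Cv) hrow_d; apply: hrowP.
Qed.

Definition free_cplx : cplx K n.
Proof.
refine (@Cplx K n (fun i => 'rV[R]_(grank G i)) freed freeC (fun i j v => v = 0)
  _ _ _ _ _ _ _ _ _ _).
- move=> [|i] a u v /=; first by rewrite scaler0 addr0.
  by rewrite mulmxDl scalemxAl.
- by move=> [|[|i]] u //=; rewrite -mulmxA (fc_dd fc) mulmx0.
- by [].
- exact: freeC_sub.
- by move=> i j; apply: zero_sub.
- by move=> i j u ->; apply: (subsp0 (freeC_sub i j)).
- exact: freeC_d.
- by move=> [|i] j u -> //=; rewrite mul0mx.
- by move=> i j y u hy Cu a; rewrite mxE; apply: hdegMy.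
- by move=> i j y u hy ->; rewrite scaler0.
Defined.

End FreeComplex.

Definition map_free (K : fieldType) (n n' : nat) (phi : {mpoly K[n]} -> {mpoly K[n']})
    (G : graded_free_data K n) : graded_free_data K n' :=
  @GradedFreeData K n' (grank G) (@gdeg _ _ G) (fun i => map_mx phi (gdiff G i))
    (map_mx phi (gaug G)).

Section Reduction.
Variables (K : fieldType) (n : nat) (x : {mpoly K[n.+1]}).
Variable phi : {lrmorphism {mpoly K[n.+1]} -> {mpoly K[n]}}.
Hypotheses (x_hom : x \is 1.-homog) (x_neq0 : x != 0).
Hypothesis q_phi : graded_quotient_map x phi.
Variables (G : graded_free_data K n.+1) (fc : free_complex G).

Let phi_homog := let: And3 h _ _ := q_phi in h.

Lemma map_free_complex : free_complex (map_free phi G).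
Proof.
split=> [i a b|i] /=.
  by rewrite mxE -(hcomp_id (fc_hom fc a b)) (phi_hcomp phi_homog) hcompP.
by rewrite -map_mxM (fc_dd fc) map_mx0.
Qed.

Lemma lpart_id (m : nat) (y : {mpoly K[m]}) : y \is 1.-homog -> lpart y = y.
Proof. exact: pihomog_dE. Qed.

(** On free modules over a domain a nonzero x is injective, and the rows killed by [phi] are the
    multiples of x. So the cone of x on F is F/xF, free over a ring with one variable less. *)
Lemma free_reduction :
  quasi_iso phi (@cone_quot_map K n.+1 n (free_cplx fc) (free_cplx map_free_complex)
    (fun i v => map_mx phi v) x).
Proof.
have [_ phi_onto phi_ker] := q_phi.
have phix : phi x = 0 by apply/phi_ker; exists 1; rewrite mulr1.
apply: cone_quotient; rewrite ?(lpart_id x_hom).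
- split.
  + by move=> i a u v; rewrite map_mxD map_mxZ.
  + move=> i j u Cu a; rewrite mxE -(hcomp_id (Cu a)) (phi_hcomp phi_homog).
    exact: hcompP.
  + by move=> i j u ->; rewrite map_mx0.
  + by move=> [|i] j u _ /=; rewrite ?map_mx0 ?map_mxM subrr.
- move=> i j u _ /= /rowP h; apply/rowP => a; have := h a; rewrite !mxE => /eqP.
  by rewrite mulf_eq0 (negbTE x_neq0) => /eqP.
- by move=> i j u _ /=; apply/rowP => a; rewrite !mxE rmorphM /= phix mul0r.
- move=> i j u' Cu'.
  have [v hv] : exists v : 'I_(grank G i) -> {mpoly K[n.+1]},
      forall a, phi (v a) = u' 0 a.
    apply: (choice_fun (P := fun a p => phi p = u' 0 a)) => a; exact: phi_onto.
  exists (hrow j (\row_a v a)); first exact: hrowP.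
  apply/rowP => a; rewrite !mxE (phi_hcomp phi_homog) hv hcomp_id ?subrr //.
  exact: Cu'.
- move=> i j u Cu /= /rowP h.
  have [q hq] : exists q : 'I_(grank G i) -> {mpoly K[n.+1]}, forall a, u 0 a = x * q a.
    apply: (choice_fun (P := fun a p => u 0 a = x * p)) => a; apply/phi_ker.
    by have := h a; rewrite !mxE.
  (* Division by x lowers the degree by one, hence the successor. *)
  exists (\row_a hcomp (gdeg a).+1 j (q a)).
    case: j {Cu} => [|j] /=; first by apply/rowP => a; rewrite !mxE.
    by move=> a; rewrite mxE; apply: (hcompP (gdeg a) j (q a)).
  apply/rowP => a; rewrite !mxE -(hcomp_id (Cu a)) hq mulrC.
  rewrite (@hcompM _ _ (gdeg a).+1) ?[x * _]mulrC ?subrr //.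
  by rewrite /hdeg leqnSn subSnn.
Qed.

End Reduction.

(** * Tor from the Koszul complex *)

Section TorDim.
Variable K : fieldType.
Local Notation R := {mpoly K[0]}.

(** Without variables R is K; this identification turns predicates on rows into row spaces, and
    [is_dim] into ranks. *)
Definition cst (r : nat) (u : 'rV[R]_r) : 'rV[K]_r := map_mx (mcoeff 0%MM) u.

Lemma cst_const r (w : 'rV[K]_r) : cst (map_mx (@mpolyC 0 K) w) = w.
Proof. by apply/rowP => a; rewrite !mxE mcoeffC eqxx mulr1. Qed.

Lemma cst_eq0 r (u : 'rV[R]_r) : cst u = 0 -> u = 0.
Proof.
move=> /rowP h; apply/rowP => a; have := h a; rewrite !mxE => e.
by rewrite [u 0 a]nvar0_mpolyC e.
Qed.

Lemma cst_lin r (a : K) (u v : 'rV[R]_r) : cst (a%:MP *: u + v) = a *: cst u + cst v.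
Proof. by apply/rowP => b; rewrite !mxE mcoeffD mcoeffCM. Qed.

Lemma cstB r (u v : 'rV[R]_r) : cst (u - v) = cst u - cst v.
Proof. by apply/rowP => b; rewrite !mxE mcoeffB. Qed.

Lemma cst_cmb r m c (v : nat -> 'rV[R]_r) :
  cst (cmb m c v) = \sum_(k < m) c k *: cst (v k).
Proof.
rewrite /cmb; elim/big_rec2: _ => [|k w u _ <-]; last exact: cst_lin.
by apply/rowP => b; rewrite !mxE mcoeff0.
Qed.

(** A row basis of the complement of B in A is a basis of A modulo B. *)
Lemma submx_dim r p q (A : 'M[K]_(p, r)) (B : 'M[K]_(q, r)) : (B <= A)%MS ->
  is_dim (fun u : 'rV[R]_r => is_true (cst u <= A)%MS)
    (fun u => is_true (cst u <= B)%MS) (\rank A - \rank B).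
Proof.
move=> sBA; pose D := row_base (A :\: B)%MS.
have eD : (D :=: A :\: B)%MS by apply: eq_row_base.
have -> : (\rank A - \rank B = \rank (A :\: B)%MS)%N.
  rewrite -(mxrank_cap_compl A B); have /capmx_idPr -> := sBA.
  by rewrite addKn.
set m := \rank (A :\: B)%MS in D eD *.
pose v (k : nat) : 'rV[R]_r :=
  if insub k is Some k' then map_mx (@mpolyC 0 K) (row k' D) else 0.
have vE (k : 'I_m) : cst (v k) = row k D by rewrite /v valK cst_const.
have cE c : cst (cmb m c v) = (\row_(k < m) c k) *m D.
  rewrite cst_cmb mulmx_sum_row; apply: eq_bigr => k _.
  by rewrite vE mxE.
exists v; split=> [k hk|z Az|c].
- rewrite (vE (Ordinal hk)) (submx_trans (row_sub _ _)) // eD.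
  exact: diffmxSl.
- have : (cst z <= (A :\: B) + B)%MS.
    apply: (submx_trans Az); rewrite -(addsmx_diff_cap_eq A B).
    by apply: addsmxS; rewrite ?submx_refl ?capmxSr.
  rewrite -(adds_eqmx eD (eqmx_refl B)) => /sub_addsmxP[[c b] /= e].
  exists (fun k => if insub k is Some k' then c 0 k' else 0).
  rewrite cstB cE e.
  have -> : \row_(k < m) (if insub (val k) is Some k' then c 0 k' else 0) = c.
    by apply/rowP => k; rewrite mxE valK.
  by rewrite addrC addKr submxMl.
- rewrite cE => hB k hk.
  have : ((\row_(k < m) c k) *m D <= (A :\: B) :&: B)%MS.
    by rewrite sub_capmx hB andbT -eD submxMl.
  rewrite capmx_diff submx0 => /eqP h0.
  have /row_free_inj inj : row_free D by apply: row_base_free.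
  have /rowP/(_ (Ordinal hk)) : \row_(k < m) c k = 0 by apply: inj; rewrite mul0mx.
  by rewrite !mxE.
Qed.

Variables (G : graded_free_data K 0) (fc : free_complex G).

(** Constants have degree 0, so an entry of a row of degree j can be nonzero only where [gdeg a] is
    j. *)
Lemma freeC_gpart i j (u : 'rV[R]_(grank G i)) :
  freeC j u <-> (cst u <= gpart G i j)%MS.
Proof.
have hd a : hdeg (gdeg a) j (u 0 a) <-> (gdeg a != j -> (u 0 a)@_0%MM = 0).
  rewrite /hdeg; case: (ltngtP (gdeg a) j) => h /=.
  - split=> [hu _|/(_ isT) h0]; last by rewrite [u 0 a]nvar0_mpolyC h0 rpred0.
    apply: (dhomog_nemf_coeff hu).
    by rewrite /= mdeg0 eq_sym -lt0n subn_gt0.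
  - split=> [/eqP -> _|/(_ isT) h0]; first by rewrite mcoeff0.
    by rewrite [u 0 a]nvar0_mpolyC h0.
  - by rewrite h subnn; split=> // _; apply: nvar0_homog.
split=> [Cu|/submxP[c e] a].
  apply/submxP; exists (cst u); apply/rowP => a.
  rewrite /gpart mul_mx_diag !mxE; case: eqP => [_|/eqP ne]; first by rewrite mulr1.
  by rewrite (proj1 (hd a) (Cu a) ne) mul0r.
apply/hd => /negbTE ne; have /rowP/(_ a) := e.
by rewrite /gpart mul_mx_diag !mxE ne mulr0.
Qed.

Lemma cst_d i (u : 'rV[R]_(grank G i.+1)) : cst (u *m gdiff G i) = cst u *m gdiffK G i.
Proof. by rewrite /cst /gdiffK map_mxM. Qed.

Lemma freeZ_gcycles i j (u : 'rV[R]_(grank G i)) :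
  cZ (X := free_cplx fc) j u <-> (cst u <= gcycles G i :&: gpart G i j)%MS.
Proof.
rewrite sub_capmx; split=> [[/freeC_gpart -> hd]|/andP[hd /freeC_gpart Cu]].
  rewrite andbT; case: i u hd => [|i] u /= hd; first by rewrite submx1.
  by apply/sub_kermxP; rewrite -cst_d hd; apply/rowP => a; rewrite !mxE mcoeff0.
split=> //; case: i u hd Cu => [|i] u //= /sub_kermxP.
by rewrite -cst_d => /cst_eq0.
Qed.

Lemma freeB_gdiffK i j (u : 'rV[R]_(grank G i)) :
  cB (X := free_cplx fc) j u <-> (cst u <= gdiffK G i :&: gpart G i j)%MS.
Proof.
rewrite sub_capmx; split=> [[/freeC_gpart -> [w Cw /= /eqP]]|/andP[/submxP[c e] hp]].
  by rewrite subr_eq0 => /eqP ->; rewrite cst_d submxMl.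
have /freeC_gpart Cu := hp; split=> //.
exists (hrow j (map_mx (@mpolyC 0 K) c)); first exact: hrowP.
rewrite /= (hrow_d fc) -(hrow_id Cu); apply/eqP; rewrite subr_eq0; apply/eqP.
congr hrow; apply/eqP; rewrite -subr_eq0; apply/eqP/cst_eq0.
by rewrite cstB cst_d cst_const e subrr.
Qed.

Lemma free_tor_dim i j : is_hdim (free_cplx fc) i j (tor_dim G i j).
Proof.
have sBZ : (gdiffK G i :&: gpart G i j <= gcycles G i :&: gpart G i j)%MS.
  apply/row_subP => k; set w := row k _; rewrite -(cst_const w).
  apply: (proj1 (freeZ_gcycles j (map_mx (@mpolyC 0 K) w))); apply: cBZ.
  by apply: (proj2 (freeB_gdiffK _ _)); rewrite cst_const row_sub.
have := submx_dim sBZ; case=> v [h1 h2 h3]; exists v; split.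
- by move=> k hk; apply/freeZ_gcycles; apply: h1.
- move=> z /freeZ_gcycles/h2[c hc]; exists c; exact/freeB_gdiffK.
- by move=> c /freeB_gdiffK; apply: h3.
Qed.

End TorDim.

(** F tensored with K depends on constant coefficients only, and a graded K-algebra map preserves
    these. *)
Lemma tor_dim_map (K : fieldType) (n n' : nat)
    (phi : {lrmorphism {mpoly K[n]} -> {mpoly K[n']}}) (G : graded_free_data K n) i j :
  (forall d p, p \is d.-homog -> phi p \is d.-homog) ->
  tor_dim (map_free phi G) i j = tor_dim G i j.
Proof.
move=> hphi; have e k : gdiffK (map_free phi G) k = gdiffK G k.
  by apply/matrixP => a b; rewrite !mxE (phi_mcoeff0 hphi).
by rewrite /tor_dim /gcycles; case: i => [|i]; rewrite !e.
Qed.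

(** Lifts to R of linear forms each of which generates the kernel of a graded
    surjection onto a polynomial ring in one variable less. *)
Fixpoint coordinates (K : fieldType) (n : nat) : seq {mpoly K[n]} -> Prop :=
  match n with
  | 0 => fun ys => ys = [::]
  | n'.+1 => fun ys => exists x ys' phi,
      [/\ ys = x :: ys', x \is 1.-homog, x != 0, graded_quotient_map x phi
        & coordinates (map phi ys')]
  end.

Lemma coordinates_size (K : fieldType) (n : nat) (ys : seq {mpoly K[n]}) :
  coordinates ys -> size ys = n.
Proof.
elim: n ys => [|n IH] ys /=; first by move=> ->.
by move=> [x [ys' [phi [-> _ _ _ /IH]]]] /=; rewrite size_map => ->.
Qed.

(** [free_reduction] trades the cone of the first form for one variable, with the other forms
    carried along by [koszul_hdim]; once all variables are gone, what remains is F tensored with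
    K. *)
Lemma koszul_free_hdim (K : fieldType) (n : nat) (G : graded_free_data K n)
    (fc : free_complex G) ys i j :
  coordinates ys -> is_hdim (koszul ys (free_cplx fc)) i j (tor_dim G i j).
Proof.
elim: n G fc ys => [|n IH] G fc ys /=; first by move=> ->; apply: free_tor_dim.
move=> [x [ys' [phi [-> hx x0 q c]]]] /=; have [hphi _ _] := q.
apply: (proj2 (koszul_hdim ys' i j _ (phi_lpart hphi) (free_reduction hx x0 q fc))).
by rewrite -(tor_dim_map G i j hphi); apply: IH.
Qed.

(** * Splitting I / xI *)

Section Ideals.
Variables (K : fieldType) (n : nat).
Local Notation R := {mpoly K[n]}.
Implicit Types (I : psubset K n) (x p q : R).

Definition hpart I j (p : R^o) : Prop := p \is j.-homog /\ I p.

Definition xR_part I x j (p : R^o) : Prop :=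
  hpart I j p /\ exists q : R, p = x * q.

Definition xI_part I x j (p : R^o) : Prop :=
  (p : R) \is j.-homog /\ exists2 q : R, I q & p = x * q.

Definition mI_part I j (p : R^o) : Prop :=
  (p : R) \is j.-homog /\ ideal_prod (@irrelevant_ideal K n) I p.

Lemma homog_lin j (a : K) (p q : R^o) : (p : R) \is j.-homog -> (q : R) \is j.-homog ->
  (a%:MP *: p + q : R) \is j.-homog.
Proof.
by move=> hp hq; apply: rpredD => //; rewrite [_ *: _]mul_mpolyC; apply: rpredZ.
Qed.

Lemma homogMy j (y p : R) : y \is 1.-homog -> p \is j.-homog -> y * p \is j.+1.-homog.
Proof. by move=> hy hp; rewrite -add1n; apply: dhomogM. Qed.

Section IsIdeal.
Variable I : psubset K n.
Hypothesis idI : is_ideal I.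

Lemma hpart_sub j : subsp (hpart I j).
Proof.
have [I0 ID IM] := idI; split=> [|a u v [hu Iu] [hv Iv]]; first by split; rewrite ?rpred0.
by split; [apply: homog_lin | apply: ID => //; apply: IM].
Qed.

Lemma xR_part_sub x j : subsp (xR_part I x j).
Proof.
have [I0 _ _] := idI; split=> [|a u v [hu [q e]] [hv [r e']]].
  by split; [split; rewrite ?rpred0 | exists 0; rewrite mulr0].
split; first by case: (hpart_sub j) => _; apply.
by exists (a%:MP * q + r); rewrite e e' mulrDr mulrCA.
Qed.

Lemma xI_part_sub x j : subsp (xI_part I x j).
Proof.
have [I0 ID IM] := idI; split=> [|a u v [hu [q Iq e]] [hv [r Ir e']]].
  by split; [rewrite rpred0 | exists 0; rewrite ?mulr0].
split; first exact: homog_lin.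
exists (a%:MP * q + r); first by apply: ID => //; apply: IM.
by rewrite e e' mulrDr mulrCA.
Qed.

Lemma mI_part_sub j : subsp (mI_part I j).
Proof.
have [I0 ID IM] := idI; split=> [|a u v [hu [s hs e]] [hv [t ht e']]].
  by split; [rewrite rpred0 | exists [::]; rewrite ?big_nil].
split; first exact: homog_lin.
exists ([seq (w.1, a%:MP * w.2) | w <- s] ++ t).
  move=> w; rewrite mem_cat => /orP[/mapP[w' /hs[h1 h2] ->]|/ht //].
  by split=> //; apply: IM.
rewrite big_cat big_map -e'; congr (_ + _); rewrite e [_ *: _]mulr_sumr.
by apply: eq_bigr => w _; rewrite mulrCA.
Qed.

Lemma xI_hpart x j p : xI_part I x j p -> hpart I j p.
Proof. by have [_ _ IM] := idI; case=> hp [q Iq e]; split=> //; rewrite e; apply: IM. Qed.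

Lemma ideal_pair : graded_pair (hpart I) (fun _ p => p = 0).
Proof.
have [I0 ID IM] := idI; split.
- exact: hpart_sub.
- by move=> _; apply: zero_sub.
- by move=> j p ->; apply: (subsp0 (hpart_sub j)).
- by move=> j y p hy [hp Ip]; split; [apply: homogMy | apply: IM].
- by move=> j y p hy ->; rewrite mulr0.
Qed.

Lemma xI_pair_y x j (y p : R) :
  y \is 1.-homog -> xI_part I x j p -> xI_part I x j.+1 (y * p).
Proof.
have [I0 ID IM] := idI; move=> hy [hp [q Iq e]]; split; first exact: homogMy.
by exists (y * q); [apply: IM | rewrite e mulrCA].
Qed.

Lemma quotient_pair x : graded_pair (hpart I) (xI_part I x).
Proof.
split; [exact: hpart_sub | exact: xI_part_sub | exact: xI_hpart | | exact: xI_pair_y].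
exact: (gpPy ideal_pair).
Qed.

End IsIdeal.

Lemma homogS_split d p : p \is d.+1.-homog ->
  exists2 c : 'I_n -> R, forall i, c i \is d.-homog & p = \sum_i c i * 'X_i.
Proof.
move=> hp; pose Pr p := exists2 c : 'I_n -> R,
  forall i, c i \is d.-homog & p = \sum_i c i * 'X_i.
suff: Pr p by [].
rewrite [p]mpolyE big_seq; apply: (big_ind Pr).
- by exists (fun=> 0) => [i|]; rewrite ?rpred0 // big1 // => i _; rewrite mul0r.
- move=> _ _ [c hc ->] [c' hc' ->]; exists (fun i => c i + c' i).
    by move=> i; apply: rpredD.
  by rewrite -big_split; apply: eq_bigr => i _; rewrite mulrDl.
- move=> m hm; have dm : mdeg m = d.+1 := dhomog_mf hp hm.
  have [i hi] : exists i, (0 < m i)%N.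
    apply/existsP; apply: contraT => /existsPn h0.
    move: dm; suff -> : m = 0%MM by rewrite mdeg0.
    by apply/mnmP => i; apply/eqP; have := h0 i; rewrite mnmE -leqn0 -leqNgt.
  have em : m = (m - U_(i) + U_(i))%MM.
    by rewrite submK //; apply/mnm_lepP => k; rewrite mnmE; case: eqP => [<-|].
  exists (fun k => if k == i then p@_m *: 'X_[m - U_(i)] else 0).
    move=> k; case: eqP => _; rewrite ?rpred0 //; apply: rpredZ.
    rewrite dhomogX /=; have := congr1 (@mdeg n) em.
    by rewrite mdegD mdeg1 dm addn1 => -[->].
  rewrite (bigD1 i) //= eqxx big1 => [|k /negbTE ->]; last by rewrite mul0r.
  by rewrite addr0 -scalerAl -mpolyXD -em.
Qed.

Lemma irrelevant_homog1 y : y \is 1.-homog -> @irrelevant_ideal K n y.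
Proof. by move=> /homogS_split[c _ ->]; exists c. Qed.

Lemma mI_partMy I j y p : y \is 1.-homog -> hpart I j p -> mI_part I j.+1 (y * p).
Proof.
move=> hy [hp Ip]; split; first exact: homogMy.
exists [:: (y, p)] => [u|]; last by rewrite big_seq1.
by rewrite inE => /eqP -> /=; split=> //; apply: irrelevant_homog1.
Qed.

Lemma homog_finite_span j : exists N (w : nat -> R^o),
  forall z : R^o, (z : R) \is j.-homog -> exists c, z = cmb N c w.
Proof.
pose N := #|{: 'X_{1..n < j.+2}}|.
pose w : nat -> R^o := fun k =>
  if insub k is Some k' then 'X_[bmnm (@enum_val 'X_{1..n < j.+2} predT k')] else 0.
exists N, w => z hz.
have hs : (msize z <= j.+2)%N.
  rewrite msizeE; apply/bigmax_leqP_seq => m hm _.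
  by rewrite (dhomog_mf hz hm).
exists (fun k => if insub k is Some k'
  then z@_(bmnm (@enum_val 'X_{1..n < j.+2} predT k')) else 0).
rewrite {1}(mpolywE hs) /cmb.
rewrite (reindex (@enum_val _ (predT : {pred 'X_{1..n < j.+2}}))) /=; last first.
  by exists enum_rank => k _; [apply: enum_valK_in | apply: enum_rankK].
by apply: eq_bigr => k _; rewrite /w valK [RHS]mul_mpolyC.
Qed.

End Ideals.

Section Augmentation.
Variables (K : fieldType) (n : nat) (I : psubset K n) (F : graded_free_data K n).
Hypotheses (homI : homogeneous_ideal I) (res : graded_free_resolution F I).
Local Notation R := {mpoly K[n]}.

Lemma resolution_complex : free_complex F.
Proof.
have [[_ hd] _ _ ex] := res; split=> [i a b|i]; first exact: hd.
apply/row_matrixP => k; rewrite row_mul row0.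
by apply/ex; exists (delta_mx 0 k); rewrite -rowE.
Qed.

Definition aug_map i : 'rV[R]_(grank F i) -> R^o :=
  match i with
  | 0 => fun v => (v *m gaug F) 0 0
  | _.+1 => fun=> 0
  end.

Local Notation XF := (free_cplx resolution_complex).
Local Notation XI := (concentrated (ideal_pair (proj1 homI))).

Lemma gaug_hrow j (v : 'rV[R]_(grank F 0)) :
  (hrow j v *m gaug F) 0 0 = pihomog mdeg j ((v *m gaug F) 0 0).
Proof.
have [[ha _] _ _ _] := res.
rewrite -[in RHS](subn0 j) -[RHS]/(hcomp 0 j _) !mxE hcomp_sum.
apply: eq_bigr => a _; rewrite mxE (@hcompM _ _ (gdeg a)) //.
by rewrite /hdeg leq0n subn0.
Qed.

Lemma augmentation_quasi_iso : @quasi_iso K n n idfun XF XI aug_map.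
Proof.
have [_ gen ex0 ex] := res; have [idI _] := homI; have fc := resolution_complex.
split; first split.
- move=> [|i] a u v /=; last by rewrite scaler0 addr0.
  by rewrite mulmxDl -scalemxAl !mxE.
- move=> [|i] j u Cu //=; split; last by apply/gen; exists u.
  by rewrite -(hrow_id Cu) gaug_hrow; apply: pihomogP.
- by move=> [|i] j u //= ->; rewrite mul0mx mxE.
- move=> [|[|i]] j u Cu /=.
  + by rewrite mul0mx mxE subr0.
  + have -> : u *m gdiff F 0 *m gaug F = 0 by apply/ex0; exists u.
    by rewrite mxE subr0.
  + by rewrite subr0.
- move=> [|i] j u [Cu du] [_ [w _]] /=; rewrite subr0.
    move=> au; have /ex0[w' e] : u *m gaug F = 0.
      by apply/matrixP => a b; rewrite !ord1 [RHS]mxE.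
    split=> //; exists (hrow j w'); first exact: hrowP.
    by rewrite /= (hrow_d fc) -e (hrow_id Cu) subrr.
  move=> _; have /ex[w' e] : u *m gdiff F i = 0 by exact: du.
  split=> //; exists (hrow j w'); first exact: hrowP.
  by rewrite /= (hrow_d fc) -e (hrow_id Cu) subrr.
- move=> [|i] j u'.
    move=> [[hu Iu] _]; have /gen[v e] := Iu.
    exists (hrow j v); first by split; first exact: hrowP.
    rewrite /= gaug_hrow -e pihomog_dE // subrr.
    exact: (subsp0 (cB_sub XI 0 j)).
  move=> [/= -> _]; exists 0; first exact: (subsp0 (cZ_sub XF i.+1 j)).
  rewrite subr0; exact: (subsp0 (cB_sub XI i.+1 j)).
Qed.

(** The bridge between a resolution and the ideal: the Koszul complex on F computes Tor, and the
    augmentation from F to I survives every cone. *)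
Lemma resolution_hdim ys i j :
  coordinates ys -> is_hdim (koszul ys XI) i j (tor_dim F i j).
Proof.
move=> hys; have := koszul_free_hdim resolution_complex i j hys.
rewrite -{2}[ys]map_id.
by apply: (proj1 (koszul_hdim ys i j _ _ augmentation_quasi_iso)).
Qed.

End Augmentation.

Section ImageIdeal.
Variables (K : fieldType) (n n' : nat).
Variable phi : {lrmorphism {mpoly K[n]} -> {mpoly K[n']}}.
Hypothesis phi_homog : forall d p, p \is d.-homog -> phi p \is d.-homog.
Hypothesis phi_onto : forall q, exists p, phi p = q.

Lemma image_homogeneous (I : psubset K n) :
  homogeneous_ideal I -> homogeneous_ideal (image_ideal phi I).
Proof.
move=> [[I0 ID IM] Ih]; split.
  split; first by exists 0; rewrite ?raddf0.
    by move=> _ _ [p Ip <-] [q Iq <-]; exists (p + q); [apply: ID | rewrite raddfD].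
  move=> p' _ [q Iq <-]; have [p <-] := phi_onto p'.
  by exists (p * q); [apply: IM | rewrite rmorphM].
move=> _ d [p Ip <-]; exists (pihomog mdeg d p); first exact: Ih.
exact: phi_pihomog.
Qed.

Lemma image_hpart (I : psubset K n) j q : homogeneous_ideal I ->
  hpart (image_ideal phi I) j q -> exists2 p, hpart I j p & phi p = q.
Proof.
move=> [_ Ih] [hq [p Ip e]]; exists (pihomog mdeg j p).
  by split; [apply: pihomogP | apply: Ih].
by rewrite (phi_pihomog phi_homog) e pihomog_dE.
Qed.

End ImageIdeal.

(** * Betti numbers along the successive quotients *)

Definition m_full (K : fieldType) (n : nat) (I : psubset K n) (x : {mpoly K[n]}) :=
  forall p, colon (ideal_prod (@irrelevant_ideal K n) I) x p <-> I p.

(** Iterating the splitting of I / xI: [b i j] is the value this predicts for the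
    Betti number beta_{i,i+j}(I). *)
Fixpoint betti_chain (K : fieldType) (n : nat) :
    psubset K n -> (nat -> nat -> nat) -> Prop :=
  match n with
  | 0 => fun I b => (forall p, I p <-> p = 0) /\ forall i j, b i j = 0%N
  | n'.+1 => fun I b => exists (x : {mpoly K[n'.+1]}) phi s b',
      [/\ x \is 1.-homog /\ x != 0, m_full I x /\ graded_quotient_map x phi,
        forall j, is_dim (xR_part I x j) (xI_part I x j) (s j),
        betti_chain (image_ideal phi I) b'
      & forall i j, b i j = (b' i j + 'C(n', i) * s j)%N]
  end.

Section ComplementExistence.
Variables (K : fieldType) (n : nat) (I : psubset K n) (x : {mpoly K[n]}).
Hypotheses (homI : homogeneous_ideal I) (x_hom : x \is 1.-homog) (full : m_full I x).
Local Notation R := {mpoly K[n]}.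
Let idI := proj1 homI.

Lemma xI_mI j p : xI_part I x j p -> mI_part I j p.
Proof.
move=> [hp [q Iq e]]; split=> //; exists [:: (x, q)]; last by rewrite big_seq1.
by move=> u; rewrite inE => /eqP -> /=; split=> //; apply: irrelevant_homog1.
Qed.

(** If xq lies in mI, then q lies in mI : x = I. *)
Lemma xR_mI j p : xR_part I x j p -> mI_part I j p -> xI_part I x j p.
Proof.
move=> [[hp Ip] [q e]] [_ hm]; split=> //; exists q => //.
by apply/full; rewrite /colon mulrC -e.
Qed.

Lemma mI_hpart j p : mI_part I j p -> hpart I j p.
Proof.
have [I0 ID IM] := idI; move=> [hp [s hs e]]; split=> //; rewrite e.
rewrite big_seq; apply: (big_ind I) => // u /hs[_ Iu]; exact: IM.
Qed.

(** For p = xq in I, the product (yq)x = yp lies in mI, so yq lies in mI : x = I. *)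
Lemma xR_trivial j (y p : R) : y \is 1.-homog -> xR_part I x j p ->
  xI_part I x j.+1 (y * p).
Proof.
move=> hy [[hp Ip] [q e]]; split; first exact: homogMy.
exists (y * q); last by rewrite e mulrCA.
apply/full; have [_ h] := mI_partMy hy (conj hp Ip).
by rewrite /colon -mulrA [q * x]mulrC -e.
Qed.

(* V = (I \cap xR)_j meets mI in xI only, so a basis of V / xI extends to a basis of
   I_j / mI_j; W is spanned by mI_j and the new basis elements. *)
Lemma complement j : exists W : R^o -> Prop,
  [/\ subsp W, forall p, mI_part I j p -> W p, forall p, W p -> hpart I j p,
    forall p, hpart I j p -> exists v w, [/\ xR_part I x j v, W w & p = v + w]
  & forall p, xR_part I x j p -> W p -> xI_part I x j p].
Proof.
have sV := xR_part_sub idI x j; have sm := mI_part_sub idI j.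
have sI := hpart_sub idI j.
have [N [w0 hw0]] := @homog_finite_span K n j.
have spn (B : R^o -> Prop) (z : R^o) : subsp B -> (z : R) \is j.-homog -> spans B N w0 z.
  by move=> sB /hw0[c ->]; exists c; rewrite subrr; apply: subsp0.
have [s [v [Vv sv iv]]] : exists s, is_dim (xR_part I x j) (xI_part I x j) s.
  apply: (@is_dim_exists _ _ _ _ _ N w0); first exact: xI_part_sub.
  by move=> z [[hz _] _]; apply: spn => //; apply: xI_part_sub.
have iv' : indep (mI_part I j) s v.
  by move=> c hc; apply: iv; apply: xR_mI => //; apply: cmb_subsp.
have [|k hk|p [u [eu Iu su iu]]] :=
    @basis_extension _ _ _ (hpart I j) (mI_part I j) N w0 s v sm _ _ iv'.
- by move=> z [hz _]; apply: spn.
- by have [] := Vv k hk.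
pose u2 k := u (s + k)%N.
have uE c : cmb (s + p) c u = cmb s c v + cmb p (fun k => c (s + k)%N) u2.
  rewrite /cmb big_split_ord /=; congr (_ + _); apply: eq_bigr => k _.
  by rewrite eu.
exists (fun z => exists c, mI_part I j (z - cmb p c u2)); split.
- split=> [|a y z [c hc] [c' hc']].
    exists (fun=> 0); rewrite sub0r /cmb big1 ?oppr0; last first.
      by move=> k _; rewrite mpolyC0 scale0r.
    exact: subsp0.
  exists (fun k => a * c k + c' k); rewrite cmbD cmbZ.
  have -> : a%:MP *: y + z - (a%:MP *: cmb p c u2 + cmb p c' u2) =
      a%:MP *: (y - cmb p c u2) + (z - cmb p c' u2) by rewrite scalerBr; zmod.
  by case: sm => _; apply.
- move=> z hz; exists (fun=> 0); rewrite /cmb big1 ?subr0 // => k _.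
  by rewrite mpolyC0 scale0r.
- move=> z [c /mI_hpart hc]; rewrite -(subrK (cmb p c u2) z).
  apply: subspD => //; apply: cmb_subsp => // k hk; apply: Iu.
  by rewrite ltn_add2l.
- move=> z hz; have [c] := su z hz; rewrite uE => hc.
  exists (cmb s c v), (z - cmb s c v); split.
  + exact: cmb_subsp.
  + exists (fun k => c (s + k)%N).
    have -> : z - cmb s c v - cmb p (fun k => c (s + k)%N) u2 =
      z - (cmb s c v + cmb p (fun k => c (s + k)%N) u2) by zmod.
    by [].
  + by zmod.
- move=> z Vz [c hc]; have [a ha] := sv z Vz.
  (* Subtracting the two expressions of z gives a relation modulo mI in the extended basis; hence
     [a] vanishes and z lies in xI. *)
  pose b k := if (k < s)%N then a k else - c (k - s)%N.
  have Bb : mI_part I j (cmb (s + p) b u).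
    rewrite uE.
    have -> : cmb s b v = cmb s a v by apply: eq_cmb => // k hk; rewrite /b hk.
    have -> : cmb p (fun k => b (s + k)%N) u2 = - cmb p c u2.
      rewrite -cmbN; apply: eq_cmb => // k hk.
      by rewrite /b ltnNge leq_addr /= addKn.
    have -> : cmb s a v - cmb p c u2 = (z - cmb p c u2) - (z - cmb s a v) by zmod.
    by apply: subspB => //; apply: xI_mI.
  have a0 k : (k < s)%N -> a k = 0.
    by move=> hk; have := iu b Bb k (ltn_addr _ hk); rewrite /b hk.
  move: ha; rewrite /cmb big1 ?subr0 // => k _.
  by rewrite a0 // mpolyC0 scale0r.
Qed.

End ComplementExistence.

Lemma homog_divx (K : fieldType) (n : nat) (x p q : {mpoly K[n]}) j :
  x \is 1.-homog -> p \is j.-homog -> p = x * q -> p = x * hcomp 1 j q.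
Proof.
move=> hx hp e; have {1}-> : p = hcomp 0 j p by rewrite hcomp_id // /hdeg leq0n subn0.
rewrite e [x * q]mulrC [x * _]mulrC; exact: hcompM.
Qed.

Section SplitStep.
Variables (K : fieldType) (n : nat) (I : psubset K n.+1) (x : {mpoly K[n.+1]}).
Variables (phi : {lrmorphism {mpoly K[n.+1]} -> {mpoly K[n]}}) (s : nat -> nat).
Hypotheses (homI : homogeneous_ideal I) (x_hom : x \is 1.-homog) (x_neq0 : x != 0).
Hypotheses (full : m_full I x) (q_phi : graded_quotient_map x phi).
Hypothesis dimV : forall j, is_dim (xR_part I x j) (xI_part I x j) (s j).
Local Notation J := (image_ideal phi I).
Let idI := proj1 homI.
Let phi_homog := let: And3 h _ _ := q_phi in h.
Let phi_ker := let: And3 _ _ h := q_phi in h.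
Hypothesis homJ : homogeneous_ideal J.

Lemma ideal_mod_x ys i j m :
  is_hdim (koszul (x :: ys) (concentrated (ideal_pair idI))) i j m <->
  is_hdim (koszul ys (concentrated (quotient_pair idI x))) i j m.
Proof.
have := @koszul_hdim K n.+1 n.+1 idfun (cone x (concentrated (ideal_pair idI)))
  (concentrated (quotient_pair idI x)) (@cone_quot_map _ _ _
  (concentrated (ideal_pair idI)) (concentrated (quotient_pair idI x))
  (fun i u => u) x) ys i j m.
rewrite map_id; apply=> //.
have [I0 ID IM] := idI.
apply: cone_quotient; rewrite ?(lpart_id x_hom).
- split=> [i0 a u v //|[|i0] j0 u //|[|i0] j0 u //=|i0 j0 u _].
    by move=> ->; apply: (subsp0 (xI_part_sub idI x j0)).
  rewrite /= subr0; case: i0 u => [|[|i0]] u //=;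
    exact: (subsp0 (xI_part_sub idI x j0)).
- by move=> [|i0] j0 u //= _ /eqP; rewrite mulf_eq0 (negbTE x_neq0) => /eqP.
- move=> [|i0] j0 u /=; last by move=> ->; rewrite scaler0.
  by move=> [hu Iu]; split; [apply: homogMy | exists u].
- move=> i0 j0 u Cu; exists u => //; rewrite subrr.
  exact: (N0 (concentrated (quotient_pair idI x)) i0 j0).
- move=> [|i0] j0 u /=.
    move=> [hu _] [_ [q Iq e]]; exists (hcomp 1 j0 q).
      case: j0 {hu} => [|j0] //=; rewrite /hcomp /= subSS subn0; split.
        exact: pihomogP.
      by have [_] := homI; apply.
    by apply/eqP; rewrite subr_eq0 (homog_divx x_hom hu e).
  move=> -> _; exists 0; last by rewrite scaler0 subr0.
  by case: j0.
Qed.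

(** The summand W/xI is isomorphic to J through [phi]: the kernel on W consists of elements of both
    V and W, that is, of xI. The other summand V/xI is killed by m and meets the n forms left after
    x, whence ['C(n, i)]. *)
Lemma split_step ys i j m : size ys = n ->
  is_hdim (koszul (map phi ys) (concentrated (ideal_pair (proj1 homJ)))) i (i + j) m ->
  is_hdim (koszul (x :: ys) (concentrated (ideal_pair idI))) i (i + j)
    (m + 'C(n, i) * s j).
Proof.
move=> hsz hm; apply/ideal_mod_x.
have [W hW] := choice_fun (complement homI x_hom full).
have sxI := xI_part_sub idI x.
have gpV : graded_pair (xR_part I x) (xI_part I x).
  split=> //; first exact: xR_part_sub.
  - move=> k p xIp; split; first exact: (xI_hpart idI xIp).
    by have [_ [q _ e]] := xIp; exists q.
  - move=> k y p hy [hp [q e]]; split; first exact: (gpPy (ideal_pair idI)).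
    by exists (y * q); rewrite e mulrCA.
  - exact: xI_pair_y.
have gpW : graded_pair W (xI_part I x).
  split=> //; first by move=> k; have [] := hW k.
  - by move=> k p hp; have [_ h _ _ _] := hW k; apply: h; apply: (xI_mI x_hom hp).
  - move=> k y p hy Wp; have [_ _ h _ _] := hW k; have [_ h' _ _ _] := hW k.+1.
    by apply: h'; apply: mI_partMy => //; apply: h.
  - exact: xI_pair_y.
have ds : direct_sum (concentrated gpW) (concentrated gpV)
    (concentrated (quotient_pair idI x)).
  exists (fun i u => u), (fun i u => u); split.
  - split=> // -[|k] l u //=.
    by have [_ _ h _ _] := hW l; apply: h.
  - by split=> // -[|k] l u //= [].
  - move=> [|k] l u /=; last by move=> ->; exists 0, 0; rewrite addr0.
    have [_ _ _ h _] := hW l => /h[v [w [? ? ->]]].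
    by exists w, v; rewrite addrC.
  - move=> [|k] l u v //= Wu Vv hN.
    have [sW hmW _ _ h] := hW l.
    have Wv : W l v.
      have -> : v = (u + v) - u by zmod.
      by apply: subspB => //; apply: hmW; apply: (xI_mI x_hom hN).
    have Nv := h v Vv Wv; split=> //.
    have -> : u = (u + v) - v by zmod.
    exact: (subspB (sxI l) hN Nv).
apply: (direct_sum_koszul ds).
  apply: (proj2 (koszul_hdim ys i (i + j) m (phi_lpart phi_homog)
    (conc_quasi_iso (g := phi) gpW (ideal_pair (proj1 homJ)) _ _ _))) => //.
  - move=> l p Wp; have [_ _ h _ _] := hW l; have [hp Ip] := h p Wp.
    by split; [apply: phi_homog | exists p].
  - move=> l p Wp; have [_ _ h _ h'] := hW l; have [hp Ip] := h p Wp.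
    split=> [[_ [q Iq e]]|/phi_ker[q e]]; first by apply/phi_ker; exists q.
    by apply: h' => //; split=> //; exists q.
  - move=> l p' /(image_hpart phi_homog homI)[p hp <-].
    have [_ _ _ h _] := hW l; have [v [w [[_ [q ev]] Ww ->]]] := h p hp.
    exists w => //; rewrite raddfD /=.
    have -> : phi v = 0 by apply/phi_ker; exists q.
    by rewrite add0r subrr.
have := @trivial_koszul K n.+1 (concentrated gpV) ys 0 s _ _ i j.
rewrite addn0 hsz; apply.
- move=> [|k] l y u hy /=; last by move=> ->; rewrite scaler0.
  exact: xR_trivial.
- move=> [|k] l; first by rewrite bin0 mul1n; apply: conc_hdim0.
  by rewrite bin0n mul0n; apply: conc_hdimS.
Qed.

End SplitStep.

Lemma betti_chain_koszul (K : fieldType) (n : nat) (I : psubset K n) b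
    (homI : homogeneous_ideal I) : betti_chain I b ->
  exists2 ys, coordinates ys & forall i j,
    is_hdim (koszul ys (concentrated (ideal_pair (proj1 homI)))) i (i + j) (b i j).
Proof.
elim: n I b homI => [|n IH] I b homI /=.
  move=> [I0 b0]; exists [::] => // i j; rewrite b0 /=.
  apply/is_dim0 => p [Cp _].
  have -> : p = 0 by case: i p Cp => [|i] p /=; [case=> _ /I0 | ].
  exact: (subsp0 (cB_sub (concentrated (ideal_pair (proj1 homI))) i (i + j))).
move=> [x [phi [s [b' [[hx x0] [full q] dimV ch hb]]]]].
have [phi_homog phi_onto _] := q.
have homJ := image_homogeneous phi_homog phi_onto homI.
have [zs hzs hd] := IH _ _ homJ ch.
(* The forms for J are lifted by arbitrary, possibly inhomogeneous preimages: only linear parts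
   enter the cones, and [phi] commutes with [lpart]. *)
have [f hf] := choice_fun phi_onto.
pose ys := map f zs.
have eys : map phi ys = zs.
  by rewrite -map_comp -[RHS]map_id; apply: eq_map => z /=; apply: hf.
exists (x :: ys).
  by exists x, ys, phi; rewrite eys.
move=> i j; rewrite hb.
apply: (split_step (phi := phi) homI _ _ _ _ _ (homJ := homJ)) => //.
  by rewrite size_map (coordinates_size hzs).
by rewrite eys.
Qed.

Lemma m_full_proper (K : fieldType) (n : nat) (I : psubset K n) :
  completely_m_full I -> ~ I 1.
Proof.
elim: n I => [|n IH] I /=; first by move=> h /h/eqP; rewrite oner_eq0.
move=> [U [_ [a Ua] /(_ a Ua)[_ [phi _ /IH h]]]] I1; apply: h.
by exists 1 => //; rewrite rmorph1.
Qed.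

Lemma betti_chain_exists (K : fieldType) (n : nat) (I : psubset K n) :
  homogeneous_ideal I -> completely_m_full I -> exists b, betti_chain I b.
Proof.
elim: n I => [|n IH] I homI full; first by exists (fun _ _ => 0%N).
have nI1 := m_full_proper full; have idI := proj1 homI.
case: full => [U [_ [a Ua] /(_ a Ua)[]]]; set x := linform a => hx [phi q hJ].
have x_hom : x \is 1.-homog.
  apply: rpred_sum => i _; apply: rpredZ; rewrite dhomogX /=.
  by rewrite mdeg1.
(* For x = 0 the colon ideal mI : x would be R, making I improper. *)
have x_neq0 : x != 0.
  apply/eqP => x0; apply: nI1; apply/hx; rewrite /colon x0 mulr0.
  by exists [::]; rewrite ?big_nil.
have [phi_homog phi_onto _] := q.
have [b' ch] := IH _ (image_homogeneous phi_homog phi_onto homI) hJ.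
have [s dimV] : exists s : nat -> nat, forall j,
    is_dim (xR_part I x j) (xI_part I x j) (s j).
  apply: (choice_fun (P := fun j m => is_dim (xR_part I x j) (xI_part I x j) m)) => j.
  have [N [w hw]] := @homog_finite_span K n.+1 j.
  apply: (@is_dim_exists _ _ _ _ _ N w); first exact: xI_part_sub.
  move=> z [[/hw[c ->] _] _]; exists c; rewrite subrr.
  exact: (subsp0 (xI_part_sub idI x j)).
by exists (fun i j => (b' i j + 'C(n, i) * s j)%N), x, phi, s, b'.
Qed.

(** Both sides are the dimension of the same Koszul homology of I, along the forms chosen by the
    chain. *)
Theorem betti_chainP (K : fieldType) (n : nat) (I : psubset K n) b beta :
  homogeneous_ideal I -> betti_chain I b -> graded_betti_numbers I beta ->
  forall i j, beta i (i + j)%N = b i j.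
Proof.
move=> homI ch [F res hbeta] i j; rewrite hbeta.
have [ys hys hd] := betti_chain_koszul homI ch.
have := resolution_hdim homI res i (i + j) hys.
by move/is_dim_uniq; apply; [apply: cB_sub | apply: hd].
Qed.

(** * The weak Lefschetz property *)

Section ChainProperties.
Variable K : fieldType.

Lemma betti_chain_eq0 n (I : psubset K n) b i j :
  betti_chain I b -> (n <= i)%N -> b i j = 0%N.
Proof.
elim: n I b => [|n IH] I b /=; first by case=> _ ->.
move=> [x [phi [s [b' [_ _ _ ch ->]]]]] hi.
by rewrite (IH _ _ ch (ltnW hi)) bin_small.
Qed.

(** [b 0 j] is the sum of the numbers [s j] over all levels of the chain, and [b i j] is a
    combination of the same numbers. *)
Lemma betti_chain_gen n (I : psubset K n) b i j :
  betti_chain I b -> b 0%N j = 0%N -> b i j = 0%N.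
Proof.
elim: n I b => [|n IH] I b /=; first by case=> _ h _; apply: h.
move=> [x [phi [s [b' [_ _ _ ch hb]]]]]; rewrite !hb bin0 mul1n.
move=> /eqP; rewrite addn_eq0 => /andP[/eqP h0 /eqP ->].
by rewrite (IH _ _ ch h0) muln0.
Qed.

(** Division by x identifies (I ∩ xR)/xI in degree j + 1 with (I : x)/I in degree j, the kernel of x
    on A_j. *)
Lemma colon_dim0 n (I : psubset K n) x j m : is_ideal I -> x \is 1.-homog -> x != 0 ->
  is_dim (xR_part I x j.+1) (xI_part I x j.+1) m ->
  m = 0%N <-> forall q, q \is j.-homog -> I (x * q) -> I q.
Proof.
move=> idI hx x0 hd; split=> [m0 q hq Ixq|h].
  move: hd; rewrite m0 => /is_dim0/(_ (x * q))[|_ [q' Iq' e]].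
    by split; [split=> //; apply: homogMy | exists q].
  by rewrite (mulfI x0 e).
apply: (is_dim_uniq (xI_part_sub idI x j.+1) hd); apply/is_dim0.
move=> p [[hp Ip] [q e]]; split=> //; exists (hcomp 1 j.+1 q).
  apply: h; last by rewrite -(homog_divx hx hp e).
  by rewrite /hcomp /= subSS subn0; apply: pihomogP.
exact: homog_divx.
Qed.

Lemma xR_dim0 n (I : psubset K n) x m : is_ideal I -> x \is 1.-homog ->
  is_dim (xR_part I x 0) (xI_part I x 0) m -> m = 0%N.
Proof.
move=> idI hx hd; have sxI := xI_part_sub idI x 0.
apply: (is_dim_uniq sxI hd); apply/is_dim0 => p [[hp _] [q e]].
by rewrite (homog_divx hx hp e) /hcomp mulr0; apply: (subsp0 sxI).
Qed.

Definition contains_from n (I : psubset K n) d :=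
  forall e p, (d <= e)%N -> p \is e.-homog -> I p.

Lemma image_contains n n' (phi : {lrmorphism {mpoly K[n]} -> {mpoly K[n']}}) I d :
  (forall d p, p \is d.-homog -> phi p \is d.-homog) ->
  (forall q, exists p, phi p = q) -> contains_from I d ->
  contains_from (image_ideal phi I) d.
Proof.
move=> hh ho hI e q he hq; have [p ep] := ho q.
exists (pihomog mdeg e p); first by apply: (hI e) => //; apply: pihomogP.
by rewrite (phi_pihomog hh) ep pihomog_dE.
Qed.

(** For j > d the quotient is zero in degree j - 1, so x has no kernel there and [s j] is 0;
    containment passes to the image ideal. *)
Lemma betti_chain_contains n (I : psubset K n) b d i j : homogeneous_ideal I ->
  betti_chain I b -> contains_from I d -> (d < j)%N -> b i j = 0%N.
Proof.
elim: n I b => [|n IH] I b homI /=; first by move=> [_ ->].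
move=> [x [phi [s [b' [[hx x0] [_ q] dimV ch ->]]]]] hI hj.
have [hh ho _] := q.
rewrite (IH _ _ (image_homogeneous hh ho homI) ch (image_contains hh ho hI) hj).
case: j hj {IH} => // j hj; suff -> : s j.+1 = 0%N by rewrite muln0.
apply/(colon_dim0 (proj1 homI) hx x0 (dimV j.+1)) => p hp _.
exact: (hI j).
Qed.

Lemma homog_nvar0 (p : {mpoly K[0]}) e : (0 < e)%N -> p \is e.-homog -> p = 0.
Proof.
by move=> he hp; apply: (homog_uniq hp (nvar0_homog mdeg p)); rewrite -lt0n.
Qed.

(** Vanishing of [s] above d makes x injective on R/I from degree d on, so each R/I in degree e >= d
    embeds in degrees beyond N, where R/I is zero. *)
Lemma betti_chain_saturated n (I : psubset K n) b d N : homogeneous_ideal I ->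
  betti_chain I b -> (0 < d)%N -> (forall j, (d < j)%N -> b 0%N j = 0%N) ->
  contains_from I N -> contains_from I d.
Proof.
move=> homI; case: n I b homI => [|n] I b homI /=.
  (* Here I = 0 and R = K, so positivity of d is what makes a form of degree e vanish. *)
  move=> [I0 _] d0 _ _ e p he hp; apply/I0.
  exact: homog_nvar0 (leq_trans d0 he) hp.
move=> [x [phi [s [b' [[hx x0] _ dimV _ hb]]]]] d0 hb0 hN.
suff h k e p : (d <= e)%N -> (N <= e + k)%N -> p \is e.-homog -> I p.
  by move=> e p he; apply: (h N) => //; apply: leq_addl.
elim: k e p => [|k IH] e p he hk hp; first by apply: (hN e); rewrite // -(addn0 e).
have s0 : s e.+1 = 0%N.
  have := hb0 e.+1 he; rewrite hb bin0 mul1n => /eqP.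
  by rewrite addn_eq0 => /andP[_ /eqP].
apply: (proj1 (colon_dim0 (proj1 homI) hx x0 (dimV e.+1)) s0 p hp).
apply: (IH e.+1); first exact: leqW.
  by rewrite addSnnS.
exact: homogMy.
Qed.

End ChainProperties.

Section Primary.
Variables (K : fieldType) (n : nat) (I : psubset K n).
Hypotheses (homI : homogeneous_ideal I) (prim : m_primary I).

(** Some power of each variable lies in I, and a monomial of degree above the sum of the exponents
    is divisible by one of these powers. *)
Lemma m_primary_contains : exists N, contains_from I N.
Proof.
have [[I0 ID IM] _] := homI; have [_ rad] := prim.
have [k hk] : exists k : 'I_n -> nat, forall i, I ('X_i ^+ k i).
  apply: (choice_fun (P := fun i k => I ('X_i ^+ k))) => i; apply/rad.
  exists (fun j => (j == i)%:R); rewrite (bigD1 i) //= eqxx mul1r big1 ?addr0 //.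
  by move=> j /negbTE ->; rewrite mul0r.
exists (\sum_i k i).+1 => e p he hp; rewrite [p]mpolyE big_seq.
apply: (big_ind I) => // m hm; rewrite -mul_mpolyC; apply: (IM).
have [i hi] : exists i, (k i <= m i)%N.
  apply/existsP; apply: contraT => /existsPn h0.
  move: he; rewrite -(dhomog_mf hp hm) /= mdegE ltnNge => /negP; case.
  by apply: leq_sum => i _; apply: ltnW; rewrite ltnNge h0.
have -> : m = ((m - U_(i) *+ k i) + U_(i) *+ k i)%MM.
  rewrite submK //; apply/mnm_lepP => l; rewrite mulmnE mnmE.
  by case: eqP => [<-|]; rewrite ?mul1n ?mul0n.
by rewrite mpolyXD -mpolyXn; apply: IM.
Qed.

Lemma top_degree_exists : exists c, top_degree I c.
Proof.
have [N hN] := m_primary_contains; have [[_ nI1 _] _] := prim.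
elim: N hN => [|N IH] hN.
  by case: nI1; apply: (hN 0%N) => //; apply: dhomog1.
have [h|h] := classic (quotient_part_zero I N); last first.
  by exists N; split=> // i hi p hp; apply: (hN i).
apply: IH => e p; rewrite leq_eqVlt => /orP[/eqP <- hp|he hp]; first exact: h.
exact: (hN e).
Qed.

End Primary.

(** The product yxq lies in mI, hence yq in mI : x = I: what x kills in R/I belongs to the socle. *)
Lemma socle_mul (K : fieldType) (n : nat) (I : psubset K n) x (y q : {mpoly K[n]}) :
  m_full I x -> y \is 1.-homog -> I (x * q) -> I (y * q).
Proof.
move=> full hy Ixq; apply/full; exists [:: (y, x * q)].
  by move=> u; rewrite inE => /eqP -> /=; split=> //; apply: irrelevant_homog1.
by rewrite big_seq1 -mulrA [q * x]mulrC.
Qed.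

(* The kernel of L on (R/I)_d contains the socle, which is the kernel of x: hence the
   rank of x is at least the rank of L. *)
Lemma surjective_transfer (K : fieldType) (n : nat) (I : psubset K n)
    (x L : {mpoly K[n]}) d : is_ideal I -> x \is 1.-homog -> L \is 1.-homog ->
  m_full I x -> mul_surjective I L d -> mul_surjective I x d.
Proof.
move=> idI hx hL full sL; have [I0 ID IM] := idI; pose R := {mpoly K[n]}.
pose Z (p : R^o) : Prop := (p : R) \is d.-homog.
pose B (p : R^o) : Prop := (p : R) \is d.-homog /\ I (x * p).
have sB : subsp B.
  split=> [|a u v [hu Iu] [hv Iv]]; first by split; rewrite ?rpred0 ?mulr0.
  split; first exact: homog_lin.
  by rewrite mulrDr mulrCA; apply: ID => //; apply: IM.
have sZ : subsp Z by split=> [|a u v hu hv]; [apply: rpred0 | apply: homog_lin].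
have [N [w hw]] := @homog_finite_span K n d.
(* [e] is a basis of R_d modulo the kernel of x, so the [x * e k] are independent modulo I; the
   [L * e k] span, because L is surjective and kills that kernel. *)
have [r [e [Ze se ie]]] : exists r, is_dim Z B r.
  apply: (@is_dim_exists _ _ _ _ _ N w sB) => z /hw[c ->].
  by exists c; rewrite subrr; apply: subsp0.
have sI := hpart_sub idI d.+1.
have cmbM (y : R) c : y * cmb r c e = cmb r c (fun k => y * e k : R^o).
  rewrite /cmb [LHS]mulr_sumr; apply: eq_bigr => k _; exact: mulrCA.
have Zc c : Z (cmb r c e) by apply: cmb_subsp.
have ix : indep (hpart I d.+1) r (fun k => x * e k : R^o).
  move=> c [_ hc]; apply: ie; split; first exact: Zc.
  by move: hc; rewrite -cmbM.
have sLe (q : R^o) : (q : R) \is d.+1.-homog ->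
    spans (hpart I d.+1) r (fun k => L * e k : R^o) q.
  move=> hq; have [p hp Iqp] := sL q hq; have [c [hpc Ic]] := se p hp.
  exists c; rewrite -cmbM; split.
    by apply: rpredB => //; apply: homogMy => //; apply: Zc.
  have -> : (q : R) - L * cmb r c e = (q - L * p) + L * (p - cmb r c e).
    by rewrite mulrBr addrA subrK.
  by apply: ID => //; apply: socle_mul full hL Ic.
have hom_ye (y : R) k : y \is 1.-homog -> (k < r)%N -> (y * e k : R) \is d.+1.-homog.
  by move=> hy hk; apply: homogMy => //; apply: Ze.
(* Both families have r members, so the equality case puts every [L * e k] in the span of the
   [x * e k]. *)
have [_ /(_ erefl) h] := indep_spans sI ix (fun k hk => sLe _ (hom_ye x k hx hk)).
have combine (a : K) (u v p p' : R) :
    a%:MP * (u - x * p) + (v - x * p') = a%:MP * u + v - x * (a%:MP * p + p').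
  by rewrite mulrBr addrACA mulrDr opprD [x * (_ * p)]mulrCA.
pose Sx (z : R^o) := exists2 p, p \is d.-homog & hpart I d.+1 (z - x * p).
have SxS : subsp Sx.
  split=> [|a u v [p hp hup] [p' hp' hvp]].
    by exists 0; rewrite ?rpred0 // mulr0 subr0; apply: subsp0.
  exists (a%:MP * p + p'); first by apply: (homog_lin a hp hp').
  suff: hpart I d.+1 (a%:MP * (u : R) + (v : R) - x * (a%:MP * p + p')) by [].
  by rewrite -combine; case: sI => _ /(_ a _ _ hup hvp).
move=> q hq; have [c hc] := sLe q hq.
suff [p hp [_ Iqp]] : Sx q by exists p.
rewrite -(subrK (cmb r c (fun k => L * e k : R^o)) q); apply: subspD => //.
  by exists 0; rewrite ?rpred0 // mulr0 subr0.
apply: cmb_subsp => // k hk; have [c' hc'] := h k hk.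
by exists (cmb r c' e); [apply: Zc | rewrite cmbM].
Qed.

Section WeakLefschetzCriterion.
Variables (K : fieldType) (n : nat) (I : psubset K n.+1) (x : {mpoly K[n.+1]}).
Variables (phi : {lrmorphism {mpoly K[n.+1]} -> {mpoly K[n]}}) (s : nat -> nat).
Hypotheses (homI : homogeneous_ideal I) (prim : m_primary I).
Hypotheses (x_hom : x \is 1.-homog) (x_neq0 : x != 0).
Hypotheses (full : m_full I x) (q_phi : graded_quotient_map x phi).
Hypothesis dimV : forall j, is_dim (xR_part I x j) (xI_part I x j) (s j).
Variable d : nat.
Hypotheses (s_d : (0 < s d.+1)%N) (s_low : forall j, (j <= d)%N -> s j = 0%N).
Local Notation J := (image_ideal phi I).

(** The d of the theorem is [d.+1] here. Surjectivity of x onto degree [d.+1] says that R is I + xR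
    there, so J is everything in that degree and hence in all higher ones. *)
Lemma weak_lefschetz_contains : weak_lefschetz I -> contains_from J d.+1.
Proof.
have [phi_homog phi_onto phi_ker] := q_phi; have [idI _] := homI.
have [[J0 JD JM] _] := image_homogeneous phi_homog phi_onto homI.
move=> [c [_ top] [L hL WL]].
have sL : mul_surjective I L d.
  (* The Lefschetz condition speaks of degrees below c only; for d >= c the target in degree [d.+1]
     is zero. For d < c injectivity of L is excluded by the socle element counted in [s d.+1]. *)
  case: (ltnP d c) => hc; last first.
    move=> q hq; exists 0; first by rewrite rpred0.
    by rewrite mulr0 subr0; apply: (top d.+1).
  case: (WL d hc) => // injL; move: s_d; suff -> : s d.+1 = 0%N by [].
  apply/(colon_dim0 idI x_hom x_neq0 (dimV d.+1)) => q hq Ixq.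
  by apply: injL => //; apply: (socle_mul full hL Ixq).
have sx := surjective_transfer idI x_hom hL full sL.
have phix : phi x = 0 by apply/phi_ker; exists 1; rewrite mulr1.
suff h k q : q \is (d.+1 + k).-homog -> J q.
  by move=> e q he; rewrite -(subnKC he); apply: h.
elim: k q => [|k IH] q.
  rewrite addn0 => hq; have [p ep] := phi_onto q.
  have [t _ It] := sx _ (pihomogP mdeg d.+1 p).
  exists (pihomog mdeg d.+1 p - x * t) => //.
  rewrite raddfB /= rmorphM /= phix mul0r subr0 (phi_pihomog phi_homog) ep.
  exact: pihomog_dE.
rewrite addnS => /homogS_split[c' hc' ->]; apply: (big_ind J) => // i _.
by rewrite mulrC; apply: (JM); apply: IH.
Qed.

(** x itself is a Lefschetz element: it is injective below degree d because [s] vanishes up to d,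
    and from degree d on it is surjective because R is I + xR in the target degree. *)
Lemma contains_weak_lefschetz : contains_from J d.+1 -> weak_lefschetz I.
Proof.
have [phi_homog phi_onto phi_ker] := q_phi; have [idI _] := homI.
move=> hJ; have [c topc] := top_degree_exists homI prim; exists c => //.
exists x => // i _; case: (ltnP i d) => hi.
  left=> p hp; apply: (proj1 (colon_dim0 idI x_hom x_neq0 (dimV i.+1))) => //.
  exact: s_low.
right=> q hq.
have [||r [hr Ir] er] := @image_hpart _ _ _ phi phi_homog I i.+1 (phi q).
- by [].
- by split; [apply: phi_homog | apply: (hJ i.+1) => //; apply: phi_homog].
have /phi_ker[t et] : phi (q - r) = 0 by rewrite raddfB /= er subrr.
have hqr : q - r \is i.+1.-homog by apply: rpredB.
exists (pihomog mdeg i t); first exact: pihomogP.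
have := homog_divx x_hom hqr et; rewrite /hcomp /= subSS subn0 => <-.
by rewrite subKr.
Qed.

End WeakLefschetzCriterion.

(** * The three equivalent conditions *)

Local Open Scope nat_scope.

Theorem corollary12 (K : fieldType) (n : nat) (I : psubset K n)
    (beta : nat -> nat -> nat) (d : nat)
    (hK : infinite_field K) (hn : 0 < n)
    (hom_I : homogeneous_ideal I) (prim_I : m_primary I)
    (full_I : completely_m_full I)
    (hbeta : graded_betti_numbers I beta)
    (d_pos : 0 < beta n.-1 (n.-1 + d))
    (d_min : forall j, 0 < beta n.-1 (n.-1 + j) -> d <= j) :
  (weak_lefschetz I <->
     forall j, d < j -> beta n.-1 (n.-1 + j) = beta 0 j) /\
  ((forall j, d < j -> beta n.-1 (n.-1 + j) = beta 0 j) <->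
     forall i j, d < j -> beta i (i + j) = 'C(n.-1, i) * beta 0 j).
Proof.
case: n I hn hom_I prim_I full_I hbeta d_pos d_min => // n I _ homI prim full hbeta.
have [b ch] := betti_chain_exists homI full.
have bE := betti_chainP homI ch hbeta.
have b0E j : beta 0 j = b 0 j := bE 0 j.
rewrite /= bE => d_pos d_min.
move: ch => /= [x [phi [s [b' [[hx x0] [mfull q] dimV ch hb]]]]].
(* J lives in n variables, so its row n is zero and the top binomial coefficient is 1. *)
have sE j : b n j = s j.
  by rewrite hb (betti_chain_eq0 j ch (leqnn n)) binn mul1n.
have [phi_homog phi_onto _] := q.
have homJ := image_homogeneous phi_homog phi_onto homI.
(* Nonzero homogeneous multiples of x have positive degree, so [s 0] is 0 and d is positive. *)
have [d' ed] : exists d', d = d'.+1.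
  case: d d_pos {d_min} => [|d']; last by exists d'.
  by rewrite sE (xR_dim0 (proj1 homI) hx (dimV 0)).
subst d; rewrite sE in d_pos.
have s_low j : j <= d' -> s j = 0.
  move=> hj; apply/eqP; rewrite -leqn0 leqNgt; apply/negP => sj.
  by have := d_min j; rewrite bE sE sj => /(_ isT); rewrite ltnNge hj.
(* Condition (ii) cancels [s j] from [b' 0 j + s j]: J has no generators above degree d. *)
have genE : (forall j, d'.+1 < j -> beta n (n + j) = beta 0 j) <->
    forall j, d'.+1 < j -> b' 0 j = 0.
  split=> h j hj; have := h j hj; rewrite bE b0E sE hb bin0 mul1n.
    by move/eqP; rewrite -[X in X == _]add0n eqn_add2r => /eqP.
  by move=> ->.
split.
  split=> [/(weak_lefschetz_contains homI hx x0 mfull q dimV d_pos) hJ|/genE h].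
    apply/genE => j hj; exact: betti_chain_contains homJ ch hJ hj.
  apply: (contains_weak_lefschetz homI prim hx x0 q dimV s_low).
  have [N hN] := m_primary_contains homI prim.
  exact: betti_chain_saturated homJ ch _ h (image_contains phi_homog phi_onto hN).
(* Condition (ii) is the case i = n of (iii); conversely, [b' 0 j = 0] clears the whole row of J and
   leaves the binomial multiples of [s j]. *)
split=> [/genE h i j hj|h j hj]; last by rewrite h // binn mul1n.
by rewrite bE b0E !hb !(betti_chain_gen _ ch (h j hj)) !add0n bin0 mul1n.
Qed.
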